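(* Let $n\ge5$ be an integer and assume that $\mathcal H_{F,r^2}(n)$ is semisimple (equivalently $r^{2k}\neq 1$ for all integers $1\le k\le n$). Let $k(n)=\dim_F K(n)$. 1. If $l=-r^3$ and $r^{2n}\ne-1$, then $K(n)$ is irreducible and $k(n)=\frac{(n-1)(n-2)}{2}$. In particular, $K(n)$ is the unique proper invariant subspace of $\mathcal V^{(n)}$. 2. If $l=-r^3$ and $r^{2n}=-1$, then $K(n)$ is reducible and $k(n)=1+\frac{(n-1)(n-2)}{2}$. Moreover, $K(n)$ is the direct sum of the unique one-dimensional invariant subspace of $\mathcal V^{(n)}$ and of the unique irreducible $\frac{(n-1)(n-2)}{2}$-dimensional invariant subspace of $\mathcal V^{(n)}$.
   Context: Let $l,r$ be nonzero complex numbers with $r^2\ne1$, $m=\frac1r-r$ and $F=\mathbb{Q}(l,r)\subseteq\mathbb{C}$. The Lawrence--Krammer space $\mathcal V^{(n)}$ is the $F$-vector space with basis $(w_{s,t})_{1\le s<t\le n}$ (also written $w_{st}$). For $1\le i\le n-1$ the generator $g_i$ acts on $\mathcal V^{(n)}$ by the endomorphism $\nu_i$ defined by: - $\nu_i(w_{i,i+1})=\frac1l w_{i,i+1}$; - $\nu_i(w_{s,i})=w_{s,i+1}$ for $s\le i-1$; - $\nu_i(w_{i+1,k})=w_{i,k}+m\,r^{k-i-2}\,w_{i,i+1}-m\,w_{i+1,k}$ for $k\ge i+2$; - $\nu_i(w_{s,i+1})=w_{s,i}+\frac{m}{l\,r^{i-s-1}}\,w_{i,i+1}-m\,w_{s,i+1}$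 for $s\le i-1$; - $\nu_i(w_{i,k})=w_{i+1,k}$ for $k\ge i+2$; - $\nu_i(w_{s,k})=r\,w_{s,k}$ in all remaining cases ($\{s,k\}\cap\{i,i+1\}=\emptyset$). An invariant subspace is a subspace stable under all $\nu_i$; proper means different from $0$ and $\mathcal V^{(n)}$; irreducible means nonzero with no invariant subspaces other than $0$ and itself. Put $\nu^{(n)}(g_i)=\nu_i$, $\nu^{(n)}(e_i)=\frac lm(\nu_i^2+m\nu_i-\mathrm{id})$, extended multiplicatively. Let $C_{i,i+1}=e_i$ and $C_{ij}=g_{j-1}^{-1}\cdots g_{i+1}^{-1}\,e_i\,g_{i+1}\cdots g_{j-1}$ for $j\ge i+2$, and $K(n)=\bigcap_{1\le i<j\le n}\ker\nu^{(n)}(C_{ij})$, which is an invariant subspace of $\mathcal V^{(n)}$. $\mathcal H_{F,r^2}(n)$ is the Iwahori--Hecke algebra of $Sym(n)$ with parameter $r^2$ over $F$, generated (after rescaling) by $g_1,\dots,g_{n-1}$ with the braid relations and $g_i^2+m\,g_i=1$. *)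

(* Defs.v *)
From HB Require Import structures.
From mathcomp Require Import all_boot all_order all_algebra.
From mathcomp Require Import boolp reals.
From mathcomp.real_closed Require Import complex.

Set Implicit Arguments.
Unset Strict Implicit.
Unset Printing Implicit Defensive.

Import GRing.Theory.
Local Open Scope ring_scope.

(* Q(l, r): the intersection of all subfields of the field C containing l and
   r. (On a field, [divring_closed] sets are exactly the subfields, since
   0^-1 = 0.) *)
Definition Qlr_pred (C : fieldType) (l r : C) : {pred C} :=
  fun z => `[< forall S : {pred C},
                 divring_closed S -> l \in S -> r \in S -> z \in S >].

Fact Qlr_divring_closed (C : fieldType) (l r : C) :
  divring_closed (Qlr_pred l r).
Proof.
split.
- by apply/asboolP => S [].
- move=> x y /asboolP xQ /asboolP yQ; apply/asboolP => S cS lS rS.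
  by case: (cS) => _ + _; apply; [apply: xQ | apply: yQ].
- move=> x y /asboolP xQ /asboolP yQ; apply/asboolP => S cS lS rS.
  by case: (cS) => _ _; apply; [apply: xQ | apply: yQ].
Qed.

HB.instance Definition _ (C : fieldType) (l r : C) :=
  GRing.isDivringClosed.Build C (Qlr_pred l r) (Qlr_divring_closed l r).

Record Qlr (C : fieldType) (l r : C) : Type :=
  MkQlr { Qlr_val : C; Qlr_valP : Qlr_val \in Qlr_pred l r }.

HB.instance Definition _ (C : fieldType) (l r : C) :=
  [isSub for @Qlr_val C l r].
HB.instance Definition _ (C : fieldType) (l r : C) :=
  [Choice of Qlr l r by <:].
HB.instance Definition _ (C : fieldType) (l r : C) :=
  [SubChoice_isSubComUnitRing of Qlr l r by <:].
HB.instance Definition _ (C : fieldType) (l r : C) :=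
  [SubComUnitRing_isSubIntegralDomain of Qlr l r by <:].
HB.instance Definition _ (C : fieldType) (l r : C) :=
  [SubIntegralDomain_isSubField of Qlr l r by <:].

Fact Qlr_l_subproof (C : fieldType) (l r : C) : l \in Qlr_pred l r.
Proof. by apply/asboolP. Qed.

Fact Qlr_r_subproof (C : fieldType) (l r : C) : r \in Qlr_pred l r.
Proof. by apply/asboolP. Qed.

Definition Qlr_l (C : fieldType) (l r : C) : Qlr l r :=
  MkQlr (Qlr_l_subproof l r).
Definition Qlr_r (C : fieldType) (l r : C) : Qlr l r :=
  MkQlr (Qlr_r_subproof l r).

Definition mparam (F : fieldType) (r : F) : F := r^-1 - r.

(* Families indexed by 1 <= i <= n - 1 are functions on nat; their values
   outside this range are irrelevant. *)
Definition hecke_relations (F : fieldType) (r : F) (n : nat)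
    (A : algType F) (g : nat -> A) : Prop :=
  [/\ forall i, (0 < i < n)%N -> g i ^+ 2 + mparam r *: g i = 1,
      forall i, (0 < i)%N -> (i.+1 < n)%N ->
        g i * g i.+1 * g i = g i.+1 * g i * g i.+1
    & forall i j, (0 < i)%N -> (i.+1 < j)%N -> (j < n)%N ->
        g i * g j = g j * g i].

(* H, with the g i as generators, is the unital associative F-algebra
   presented by [hecke_relations]; it is thus determined up to isomorphism.
   The usual generators T_i = r g_i satisfy (T_i - r^2)(T_i + 1) = 0. *)
Definition is_hecke_algebra (F : fieldType) (r : F) (n : nat)
    (H : algType F) (g : nat -> H) : Prop :=
  hecke_relations r n g /\
  forall (B : algType F) (h : nat -> B), hecke_relations r n h ->
    exists f : {lrmorphism H -> B},
      (forall i, (0 < i < n)%N -> f (g i) = h i) /\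
      forall f' : {lrmorphism H -> B},
        (forall i, (0 < i < n)%N -> f' (g i) = h i) -> f' =1 f.

Definition left_ideal (A : nzRingType) (I : A -> Prop) : Prop :=
  [/\ I 0, forall x y, I x -> I y -> I (x + y) & forall a x, I x -> I (a * x)].

(* The regular left module is completely reducible. *)
Definition semisimple_ring (A : nzRingType) : Prop :=
  forall I : A -> Prop, left_ideal I ->
    exists J : A -> Prop,
      [/\ left_ideal J,
          forall x, I x -> J x -> x = 0
        & forall x, exists y z, [/\ I y, J z & x = y + z]].

(* The pairs (s, t) with 1 <= s < t <= n. *)
Definition LKindex (n : nat) : finType :=
  {p : 'I_n.+1 * 'I_n.+1 | (0 < p.1)%N && (p.1 < p.2)%N}.

Definition LKspace (F : fieldType) (n : nat) : vectType F :=
  {ffun LKindex n -> F^o}.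

(* The basis vector w_{s,t} when 1 <= s < t <= n (and 0 otherwise). *)
Definition LKw (F : fieldType) (n s t : nat) : LKspace F n :=
  [ffun p : LKindex n =>
    (((val p).1 == s :> nat) && ((val p).2 == t :> nat))%:R].

Section LawrenceKrammer.
Variables (F : fieldType) (l r : F) (n : nat).
Local Notation V := (LKspace F n).
Local Notation w := (LKw F n).
Local Notation m := (mparam r).

(* nu_i (w_{s,t}), for s < t *)
Definition LKnu_basis (i s t : nat) : V :=
  if (s == i) && (t == i.+1) then l^-1 *: w i i.+1
  else if t == i then w s i.+1
  else if s == i.+1 then
    w i t + (m * r ^+ (t - i - 2)) *: w i i.+1 - m *: w i.+1 t
  else if t == i.+1 then
    w s i + (m / (l * r ^+ (i - s - 1))) *: w i i.+1 - m *: w s i.+1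
  else if s == i then w i.+1 t
  else r *: w s t.

Definition LKnu_fun (i : nat) (v : V) : V :=
  \sum_(p : LKindex n) v p *: LKnu_basis i (val p).1 (val p).2.

Fact LKnu_fun_is_linear i : linear (LKnu_fun i).
Proof.
move=> a u v; rewrite /LKnu_fun scaler_sumr -big_split /=.
by apply: eq_bigr => p _; rewrite !ffunE scalerDl scalerA.
Qed.

HB.instance Definition _ i :=
  GRing.isLinear.Build F V V *:%R (LKnu_fun i) (LKnu_fun_is_linear i).

Definition LKnu (i : nat) : 'End(V) := linfun (LKnu_fun i).

Fact LKnu_w i s t : (0 < s < t)%N -> (t <= n)%N ->
  LKnu i (w s t) = LKnu_basis i s t.
Proof.
move=> /andP[s0 st] tn; rewrite lfunE /= /LKnu_fun.
have sn : (s < n.+1)%N by rewrite ltnS (leq_trans (ltnW st)).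
have tn' : (t < n.+1)%N by [].
have hp : (0 < (Ordinal sn, Ordinal tn').1)%N &&
  ((Ordinal sn, Ordinal tn').1 < (Ordinal sn, Ordinal tn').2)%N by rewrite /= s0.
pose p : LKindex n := exist _ (Ordinal sn, Ordinal tn') hp.
rewrite (bigD1 p) //= ffunE /= !eqxx scale1r big1 ?addr0 // => q qp.
rewrite ffunE /=; case: andP => [[/eqP e1 /eqP e2]|_]; last by rewrite scale0r.
case/eqP: qp; apply: val_inj; case: q e1 e2 => -[a b] /= _ e1 e2.
by congr pair; apply: val_inj.
Qed.

Definition LKe (i : nat) : 'End(V) :=
  (l / m) *: ((LKnu i \o LKnu i)%VF + m *: LKnu i - \1%VF).

(* nu(C_{i,j}) for i < j: conjugate e_i by g_{i+1}, ..., g_{j-1} in turn.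
   (Each LKnu k is invertible, so that ^-1%VF is its inverse.) *)
Definition LKC (i j : nat) : 'End(V) :=
  foldl (fun c k => ((LKnu k)^-1 \o c \o LKnu k)%VF) (LKe i)
        (index_iota i.+1 j).

Definition LKker : {vspace V} :=
  (\bigcap_(p : LKindex n) lker (LKC (val p).1 (val p).2))%VS.

Definition LKinvariant (U : {vspace V}) : Prop :=
  forall i, (0 < i < n)%N -> (LKnu i @: U <= U)%VS.

Definition LKproper (U : {vspace V}) : Prop := U <> 0%VS /\ U <> fullv.

Definition LKirreducible (U : {vspace V}) : Prop :=
  [/\ LKinvariant U, U <> 0%VS &
      forall W : {vspace V}, (W <= U)%VS -> LKinvariant W ->
        W = 0%VS \/ W = U].

Definition LKreducible (U : {vspace V}) : Prop :=
  LKinvariant U /\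
  exists W : {vspace V},
    [/\ (W <= U)%VS, LKinvariant W, W <> 0%VS & W <> U].

End LawrenceKrammer.

(* Main.v *)
From HB Require Import structures.
Require Import Defs.
From mathcomp Require Import all_boot all_order all_algebra.
From mathcomp Require Import reals.
From mathcomp.real_closed Require Import complex.
From mathcomp Require Import zify ring.

Import GRing.Theory.
Local Open Scope ring_scope.

Set Implicit Arguments.
Unset Strict Implicit.
Unset Printing Implicit Defensive.

(** For l = -r^3 the vectors u_ab of [LKu] satisfy
    (nu_k - r) u_ab = T_ka u_kb - T_kb u_ka with T = tridiag(1, -(r + 1/r), 1), so
    they span a copy S of the exterior square of the reduced Burau representation,
    of dimension (n-1)(n-2)/2. Suitable polynomials in the nu_k - r send u_ab to a
    2x2 minor of T times u_ij; as T is invertible when r^(2n) <> 1, every nonzero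
    invariant subspace of S contains some u_ij and hence is S.
    Each e_i maps V into the line of w_{i,i+1}, so an invariant subspace is either
    killed by all the e_i, hence inside K, or contains some w_{i,i+1}, hence is V.
    The matrix of the e_i on the w_{j,j+1} is tridiag(1, -(r^2 + r^-2), 1), whose
    leading minors show that K has codimension at least n - 1, or n - 2 when
    r^(2n) = -1; in the latter case sum_{s<t} r^(s+t) w_{s,t} is an eigenvector of
    all the nu_i, and it lies outside S.
    Semisimplicity enters only through r^2 <> -1 and r^(2n) <> 1: otherwise a
    2-dimensional representation, respectively the Burau representation, contains the
    character g_i |-> r both as a submodule and as a quotient, in a nonsplit way. *)

(** * A three-term recurrence and preliminaries on indices *)

(** The characteristic roots are q and 1/q, so [y k] is [y 1] times the quantum integer [k];
    [q ^+ (2 * n) != 1] ensures both q <> 1/q and [n] <> 0. With q = r or q = r^2 this inverts the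
    tridiagonal matrices below. *)
Lemma quantum_recurrence (F : fieldType) (q : F) (n : nat) (y : nat -> F) :
  q != 0 -> q ^+ (2 * n) != 1 -> y 0%N = 0 -> y n = 0 ->
  (forall k, (0 < k < n)%N -> y k.-1 - (q + q^-1) * y k + y k.+1 = 0) ->
  forall k, (k <= n)%N -> y k = 0.
Proof.
move=> q0 qn y0 yn yrec.
have q2 : q - q^-1 != 0.
  apply: contraNneq qn => /eqP; rewrite subr_eq0 => /eqP qV.
  by rewrite exprM expr2 {2}qV divff // expr1n.
have yE k : (k <= n)%N -> y k * (q - q^-1) = y 1%N * (q ^+ k - q ^- k).
  elim/ltn_ind: k => -[|[|k]] IH kn; first by rewrite y0 !expr0 invr1; ring.
    by rewrite !expr1.
  have -> : y k.+2 = (q + q^-1) * y k.+1 - y k.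
    by apply/eqP; rewrite -subr_eq0 -(yrec k.+1) ?kn //=; apply/eqP; ring.
  rewrite mulrBl -mulrA IH ?(ltnW kn) // IH //; last by lia.
  by rewrite !exprS; field; rewrite q0 expf_neq0.
have y1 : y 1%N = 0.
  have /eqP := yE n (leqnn n).
  rewrite yn mul0r eq_sym mulf_eq0 => /orP[/eqP-> //|].
  rewrite subr_eq0 => /eqP qV; case/negP: qn.
  by rewrite mul2n -addnn exprD {2}qV divff // expf_neq0.
move=> k kn; apply: (mulIf q2); by rewrite yE // y1 !mul0r.
Qed.

Lemma card_LKindex n : #|LKindex n| = 'C(n, 2).
Proof.
rewrite card_sig -sum1_card.
have -> : (\sum_(p : 'I_n.+1 * 'I_n.+1 | (0 < p.1)%N && (p.1 < p.2)%N) 1 =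
  \sum_(j < n.+1) \sum_(i < n.+1 | (0 < i)%N && (i < j)%N) 1)%N.
  rewrite (exchange_big_dep (fun i : 'I_n.+1 => (0 < i)%N)) /=;
    last by move=> j i _ /andP[].
  by rewrite pair_big_dep; apply: eq_bigl => -[a b] /=; case: (0 < a)%N.
rewrite -bin2_sum big_ord_recl [X in (X + _)%N]big_pred0 ?add0n;
  last by move=> i /=; lia.
rewrite big_mkord; apply: eq_bigr => j _.
rewrite -(big_mkord (fun i => (0 < i)%N && (i < bump 0 j)%N) (fun _ => 1%N)).
rewrite -big_nat_widen; last by rewrite /bump /= add1n; have := ltn_ord j; lia.
rewrite big_mkcond /= /bump leq0n add1n big_nat_recl //= add0n.
by rewrite sum_nat_const_nat subn0 muln1.
Qed.

(** A multirule, so that rewriting with it at a fixed [f] pushes [f] through a whole linear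
    combination. *)
Lemma lfun_linearE (F : fieldType) (V : vectType F) (f : 'End(V)) :
  (forall x y, f (x + y) = f x + f y) * (forall x y, f (x - y) = f x - f y)
  * (forall a x, f (a *: x) = a *: f x) * (f 0 = 0)
  * (forall x, f (- x) = - f x).
Proof.
split; first split; first split; first split.
- exact: linearD.
- exact: linearB.
- exact: linearZZ.
- exact: linear0.
- exact: linearN.
Qed.

(** * The generators on the basis vectors *)

Section GeneratorAction.
Variables (F : fieldType) (l r : F) (n : nat).
Local Notation w := (LKw F n).
Local Notation m := (mparam r).
Local Notation nu := (LKnu l r n).

Lemma LKw_out s t : ~~ ((0 < s < t)%N && (t <= n)%N) -> w s t = 0.
Proof.
move=> st; apply/ffunP => p; rewrite !ffunE.
case: andP => // -[/eqP es /eqP et]; case/negP: st; rewrite -es -et.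
by have := valP p => /= ->; rewrite -ltnS ltn_ord.
Qed.

Lemma LK_sum_w (v : LKspace F n) : v = \sum_p v p *: w (val p).1 (val p).2.
Proof.
apply/ffunP => q; rewrite sum_ffunE (bigD1 q) //= !ffunE !eqxx.
rewrite [_ *: _]mulr1 big1 ?addr0 // => p pq; rewrite !ffunE.
case: andP => [[/eqP e1 /eqP e2]|_]; last by rewrite scaler0.
case/eqP: pq; apply: val_inj; case: p q e1 e2 => -[a b] /= _ [[c d] /= _] e1 e2.
by congr pair; apply: val_inj.
Qed.

Lemma LKindex_exists s t : (0 < s < t)%N -> (t <= n)%N ->
  exists p : LKindex n, (val p).1 = s :> nat /\ (val p).2 = t :> nat.
Proof.
move=> /andP[s0 st] tn.
have sn : (s < n.+1)%N by rewrite ltnS (leq_trans (ltnW st)).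
have tn' : (t < n.+1)%N by [].
have hp : (0 < (Ordinal sn, Ordinal tn').1)%N &&
  ((Ordinal sn, Ordinal tn').1 < (Ordinal sn, Ordinal tn').2)%N by rewrite /= s0.
by exists (exist _ (Ordinal sn, Ordinal tn') hp).
Qed.

Lemma nu_w_disjoint i s t : s != i -> s != i.+1 -> t != i -> t != i.+1 ->
  nu i (w s t) = r *: w s t.
Proof.
move=> /negPf si /negPf si1 /negPf ti /negPf ti1.
have [st|/LKw_out->] := boolP ((0 < s < t)%N && (t <= n)%N); last first.
  by rewrite linear0 scaler0.
case/andP: st => st tn.
by rewrite LKnu_w // /LKnu_basis si si1 ti ti1.
Qed.

Lemma nu_w_simple i : (0 < i < n)%N -> nu i (w i i.+1) = l^-1 *: w i i.+1.
Proof.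
by case/andP=> i0 ni; rewrite LKnu_w ?i0 ?ltnSn // /LKnu_basis !eqxx.
Qed.

Lemma nu_w_right i s : (i < n)%N -> (s < i)%N -> nu i (w s i) = w s i.+1.
Proof.
move=> ni si; have [s0|s0] := posnP s.
  by rewrite s0 !LKw_out ?linear0 // ltnn.
by rewrite LKnu_w ?s0 ?si ?(ltnW ni) // /LKnu_basis (ltn_eqF si) eqxx.
Qed.

Lemma nu_w_rightS i s : (i < n)%N -> (0 < s < i)%N ->
  nu i (w s i.+1) =
    w s i + (m / (l * r ^+ (i - s - 1))) *: w i i.+1 - m *: w s i.+1.
Proof.
move=> ni /andP[s0 si]; rewrite LKnu_w // ?s0 ?ltnS ?(ltnW si) //.
rewrite /LKnu_basis (ltn_eqF si) eqxx (gtn_eqF (ltnSn i)) /=.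
by rewrite (ltn_eqF (leq_trans si (leqnSn i))).
Qed.

Lemma nu_w_left i k : (0 < i)%N -> (i.+1 < k)%N -> nu i (w i k) = w i.+1 k.
Proof.
move=> i0 ik; have [kn|kn] := leqP k n; last first.
  by rewrite !LKw_out ?linear0 // negb_and -!ltnNge kn orbT.
rewrite LKnu_w // ?i0 ?(ltnW ik) // /LKnu_basis eqxx (gtn_eqF ik) /=.
by rewrite (gtn_eqF (ltnW ik)) (ltn_eqF (ltnSn i)).
Qed.

Lemma nu_w_leftS i k : (0 < i)%N -> (i.+1 < k)%N -> (k <= n)%N ->
  nu i (w i.+1 k) =
    w i k + (m * r ^+ (k - i - 2)) *: w i i.+1 - m *: w i.+1 k.
Proof.
move=> i0 ik kn; rewrite LKnu_w // /LKnu_basis (gtn_eqF (ltnSn i)) /=.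
by rewrite (gtn_eqF (ltnW ik)) eqxx.
Qed.

End GeneratorAction.

(** Minus the quantum Cartan matrix of type A, indexed by nat so that it serves every size. It
    occurs with q = r in the Burau representation and with q = r^2 for the operators e_i. *)
Definition tridiag (F : fieldType) (q : F) (i j : nat) : F :=
  if i == j then - (q + q^-1) else if (i == j.+1) || (j == i.+1) then 1 else 0.

Lemma tridiag_diag (F : fieldType) (q : F) i j :
  i = j -> tridiag q i j = - (q + q^-1).
Proof. by move=> ->; rewrite /tridiag eqxx. Qed.

Lemma tridiag_next (F : fieldType) (q : F) i j :
  (i == j.+1) || (j == i.+1) -> tridiag q i j = 1.
Proof. by move=> ij; rewrite /tridiag ij ifN //; lia. Qed.

Lemma tridiag_far (F : fieldType) (q : F) i j :
  (i.+1 < j)%N || (j.+1 < i)%N -> tridiag q i j = 0.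
Proof. by move=> ij; rewrite /tridiag !ifN //; lia. Qed.

(** * The exterior square of the reduced Burau representation *)

Section ExteriorSquare.
Variables (F : fieldType) (r : F) (n : nat).
Hypothesis r0 : r != 0.
Local Notation l := (- r ^+ 3).
Local Notation w := (LKw F n).
Local Notation m := (mparam r).
Local Notation nu := (LKnu l r n).
Local Notation T := (tridiag r).

(** Since [w s t] is 0 unless 1 <= s < t <= n, at most one term survives: this is the antisymmetric
    extension of [w], in the role of s /\ t. *)
Definition LKwA s t : LKspace F n := w s t - w t s.

(* The vectors u_a /\ u_b, with u_a = a - (a+1)/r, in the exterior square of the
   n-dimensional Burau space. *)
Definition LKu a b : LKspace F n :=
  LKwA a b - r^-1 *: (LKwA a.+1 b + LKwA a b.+1) + r^-2 *: LKwA a.+1 b.+1.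
Local Notation u := LKu.

Lemma LKu_anti a b : u a b = - u b a.
Proof.
rewrite /LKu /LKwA; apply/ffunP => p; rewrite !ffunE.
by rewrite /GRing.scale /=; ring.
Qed.

Lemma LKu_diag a : u a a = 0.
Proof.
rewrite /LKu /LKwA !subrr add0r; apply/ffunP => p; rewrite !ffunE.
by rewrite /GRing.scale /=; ring.
Qed.

Let nuE i := lfun_linearE (nu i).

Ltac kill_w := repeat match goal with
  | |- context [LKw F n ?s ?t] => rewrite (@LKw_out F n s t); [|lia]
  end.
Ltac eval_T := repeat match goal with
  | |- context [tridiag r ?s ?t] =>
    first [ rewrite (@tridiag_far F r s t); [|lia]
          | rewrite (@tridiag_next F r s t); [|lia]
          | rewrite (@tridiag_diag F r s t); [|lia] ]
  end.
(* Writes the truncated exponents of the [nu_w] lemmas as cs + j, so that [field]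
   sees powers of r with a common base. *)
Ltac eval_sub cs := repeat match goal with
  | |- context [r ^+ (?x - ?y - ?z)] =>
     first [ replace (x - y - z)%N with 0%N by lia
           | replace (x - y - z)%N with 1%N by lia
           | replace (x - y - z)%N with cs by lia
           | replace (x - y - z)%N with cs.+1 by lia
           | replace (x - y - z)%N with cs.+2 by lia
           | replace (x - y - z)%N with cs.+3 by lia]
  end.
Ltac eval_nu := repeat match goal with
  | |- context [LKnu ?l r n ?k] => match goal with |- context [LKw F n ?s ?t] =>
    first [ rewrite (@nu_w_disjoint F l r n k s t); [|lia|lia|lia|lia]
          | rewrite (@nu_w_simple F l r n k); [|lia]
          | rewrite (@nu_w_right F l r n k s); [|lia|lia]
          | rewrite (@nu_w_left F l r n k t); [|lia|lia]
          | rewrite (@nu_w_rightS F l r n k s); [|lia|lia]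
          | rewrite (@nu_w_leftS F l r n k t); [|lia|lia|lia] ]
  end end.
Ltac gen_w := repeat match goal with
  | |- context [LKw F n ?s ?t] => generalize (LKw F n s t)
  end.
Ltac finish :=
  apply/ffunP => ?; rewrite !ffunE /GRing.scale /= /mparam ?exprS;
  field; rewrite ?(oppr_eq0, mulf_eq0, expf_eq0, oner_eq0, negPf r0, andbF, orbF) //.
(** Once the generators are evaluated, the basis vectors become arbitrary vectors, and a
    coordinatewise identity of rational functions in r is left to [field]. *)
Ltac solve_case cs :=
  rewrite /LKu /LKwA; eval_T; kill_w; rewrite ?nuE;
  rewrite ?(scale0r, subr0, sub0r, addr0, add0r, scaler0);
  eval_nu; eval_sub cs; kill_w;
  rewrite ?(scale0r, subr0, sub0r, addr0, add0r, scaler0);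
  gen_w; intros; finish.

(** A finite check: k matters only near a or b, and the gap b - a matters only when it is 1 or 2,
    where the neighbours of a and of b overlap. *)
Lemma nu_LKu_lt k a b : (0 < k < n)%N -> (0 < a < b)%N -> (b < n)%N ->
  nu k (u a b) = r *: u a b + T k a *: u k b - T k b *: u k a.
Proof.
move=> kn ab bn.
(* Here both entries of T vanish and {k, k+1} misses a, a+1, b and b+1. *)
have [far|] := boolP [|| (k.+1 < a)%N, (b.+1 < k)%N | (a.+1 < k)%N && (k.+1 < b)%N].
  solve_case 0%N.
have [c2|[c1|[c cE]]] : b = a.+1 \/ b = a.+2 \/ exists c, (b - a = c + 3)%N.
- by case: (ltngtP b a.+1); [lia| |lia] => ?; right; case: (ltngtP b a.+2);
    [lia| |lia] => ?; right; exists (b - a - 3)%N; lia.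
- subst b => near.
  have [kE|[kE|[kE|kE]]] : a = k.+1 \/ k = a \/ k = a.+1 \/ k = a.+2 by lia.
  + subst a. solve_case 0%N.
  + subst k. solve_case 0%N.
  + subst k. solve_case 0%N.
  + subst k. solve_case 0%N.
- subst b => near.
  have [kE|[kE|[kE|[kE|kE]]]] :
      a = k.+1 \/ k = a \/ k = a.+1 \/ k = a.+2 \/ k = a.+3 by lia.
  + subst a. solve_case 0%N.
  + subst k. solve_case 0%N.
  + subst k. solve_case 0%N.
  + subst k. solve_case 0%N.
  + subst k. solve_case 0%N.
move=> near.
have [kE|[kE|[kE|[kE|[kE|kE]]]]] :
    a = k.+1 \/ k = a \/ k = a.+1 \/ b = k.+1 \/ k = b \/ k = b.+1 by lia.
- subst a. solve_case c.
- subst k. solve_case c.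
- subst k. solve_case c.
- subst b. solve_case c.
- subst k. solve_case c.
- subst k. solve_case c.
Qed.

Lemma nu_LKu k a b : (0 < k < n)%N -> (0 < a < n)%N -> (0 < b < n)%N ->
  nu k (u a b) = r *: u a b + T k a *: u k b - T k b *: u k a.
Proof.
move=> kn an bn; have [ab|ba|->] := ltngtP a b.
- by apply: nu_LKu_lt; lia.
- rewrite LKu_anti nuE nu_LKu_lt; [|lia|lia|lia].
  by rewrite scalerN !opprD opprK -!addrA; congr (_ + _); rewrite addrC.
- by rewrite LKu_diag nuE scaler0 add0r subrr.
Qed.

End ExteriorSquare.

Lemma lfun_sumE (F : fieldType) (V : vectType F) (f : 'End(V))
    (I : finType) (G : I -> V) : f (\sum_i G i) = \sum_i f (G i).
Proof. exact: linear_sum. Qed.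

Lemma lfun_shiftE (F : fieldType) (V : vectType F) (f : 'End(V)) a x :
  (f - a *: \1%VF) x = f x - a *: x.
Proof. by rewrite add_lfunE opp_lfunE scale_lfunE id_lfunE. Qed.

Lemma LKindex_bounds n (p : LKindex n.-1) :
  [/\ (0 < (val p).1)%N, ((val p).1 < (val p).2)%N & ((val p).2 < n)%N].
Proof. case: p => -[a b] /= /andP[a0 ab]; have := ltn_ord b; split=> //; lia. Qed.

(** * Irreducibility of the exterior square, for abstract operators D_k in place of nu_k - r *)

Section ExteriorSquareIrreducible.
Variables (F : fieldType) (r : F) (n : nat) (V : vectType F).
Hypothesis r0 : r != 0.
Hypothesis rV0 : r + r^-1 != 0.
Local Notation T := (tridiag r).
Variables (D : nat -> 'End(V)) (u : nat -> nat -> V).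
Hypothesis u_anti : forall a b, u a b = - u b a.
Hypothesis u_diag : forall a, u a a = 0.
Hypothesis D_u : forall k a b, (0 < k < n)%N -> (0 < a < n)%N -> (0 < b < n)%N ->
  D k (u a b) = T k a *: u k b - T k b *: u k a.

(** The entries of the exterior square of T. *)
Definition tridiag_minor i j a b : F := T i a * T j b - T i b * T j a.

(** An operator sending the whole span into the line of [u i j]. For j = i + 1 the product D_i D_j
    D_i yields D_i plus T_ii times the wanted operator, hence the subtraction and the division by
    -(r + 1/r). *)
Definition exterior_projection i j : 'End(V) :=
  if (i.+1 < j)%N then (D i \o D j)%VF
  else (- (r + r^-1))^-1 *: ((D i \o D j \o D i)%VF - D i).

Lemma exterior_projection_u i j a b : (0 < i < j)%N -> (j < n)%N ->
  (0 < a < n)%N -> (0 < b < n)%N ->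
  exterior_projection i j (u a b) = tridiag_minor i j a b *: u i j.
Proof.
move=> ij jn an bn; have [hi hj] : (0 < i < n)%N /\ (0 < j < n)%N by lia.
rewrite /exterior_projection /tridiag_minor; case: ifP => far.
  rewrite comp_lfunE D_u // !(lfun_linearE (D i)) !D_u //.
  rewrite (@tridiag_far _ r i j) ?far // !scale0r !sub0r.
  rewrite !scalerN !scalerA opprK addrC -scalerBl.
  by congr (_ *: _); ring.
have {far ij} jE : j = i.+1 by lia.
have Tij : T i j = 1 by rewrite tridiag_next // jE eqxx orbT.
have Tji : T j i = 1 by rewrite tridiag_next // jE eqxx.
have -> : (D i \o D j \o D i)%VF = (D i \o (D j \o D i))%VF by rewrite comp_lfunA.
rewrite scale_lfunE add_lfunE opp_lfunE 2!comp_lfunE.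
(* D_i maps the first two terms back to D_i (u a b), as their contributions along [u i j] cancel,
   and multiplies the last term by T_ii. *)
have -> : D j (D i (u a b)) = T i a *: u j b - T i b *: u j a
    + tridiag_minor i j a b *: u i j.
  rewrite D_u // !(lfun_linearE (D j)) !D_u // Tji !scale1r (u_anti j i).
  rewrite !scalerN !opprK !scalerDr !scalerA /tridiag_minor scalerBl !opprD.
  by rewrite addrACA.
rewrite !(lfun_linearE (D i)) !D_u // Tij !scale1r u_diag subr0.
rewrite (tridiag_diag r (erefl i)).
rewrite !scalerBr !scalerA.
have -> : T i a *: u i b - (T i a * T i b) *: u i j -
   (T i b *: u i a - (T i b * T i a) *: u i j) = T i a *: u i b - T i b *: u i a.
  by rewrite opprB [T i b * _]mulrC subrKA.
rewrite -/(tridiag_minor i j a b) -2![in X in _ - X]scalerA -scalerBr -scalerBr.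
rewrite [X in _ *: (X - _)]addrC addrK scalerA mulrCA mulVf ?mulr1 //.
by rewrite oppr_eq0.
Qed.

(** [LKindex n.-1] because the indices of [u] run from 1 to n - 1 only. *)
Definition exterior_span : {vspace V} :=
  (\sum_(p : LKindex n.-1) <[u (val p).1 (val p).2]>)%VS.

Lemma exterior_span_u a b : (0 < a < n)%N -> (0 < b < n)%N ->
  u a b \in exterior_span.
Proof.
have lt_span c d : (0 < c < d)%N -> (d < n)%N -> u c d \in exterior_span.
  move=> cd dn; have [|p [<- <-]] := @LKindex_exists n.-1 c d cd; first lia.
  by apply: (subvP (sumv_sup p _ (subvv _))) => //; apply: memv_line.
move=> an bn; have [ab|ba|->] := ltngtP a b; last by rewrite u_diag mem0v.
- by apply: lt_span; lia.
- by rewrite u_anti memvN; apply: lt_span; lia.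
Qed.

Lemma exterior_span_sub (U : {vspace V}) :
  (forall a b, (0 < a < b)%N -> (b < n)%N -> u a b \in U) ->
  (exterior_span <= U)%VS.
Proof.
move=> uU; apply/subv_sumP => p _; rewrite -memvE.
by have [p1 p12 p2] := LKindex_bounds p; apply: uU; rewrite ?p1.
Qed.

Lemma exterior_span_coord x : x \in exterior_span ->
  exists v : LKindex n.-1 -> F, x = \sum_p v p *: u (val p).1 (val p).2.
Proof.
case/memv_sumP => y yu ->.
have [v vE] := fin_all_exists (fun p => vlineP _ _ (yu p isT)).
by exists v; apply: eq_bigr => p _.
Qed.

Lemma exterior_projection_sum (v : LKindex n.-1 -> F) i j :
  (0 < i < j)%N -> (j < n)%N ->
  exterior_projection i j (\sum_p v p *: u (val p).1 (val p).2) =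
  (\sum_p v p * tridiag_minor i j (val p).1 (val p).2) *: u i j.
Proof.
move=> ij jn; rewrite lfun_sumE scaler_suml; apply: eq_bigr => p _.
have [p1 p12 p2] := LKindex_bounds p.
rewrite (lfun_linearE (exterior_projection i j)).
by rewrite exterior_projection_u ?scalerA //; lia.
Qed.

Lemma exterior_projection_stable (U : {vspace V}) i j :
  (forall k x, (0 < k < n)%N -> x \in U -> D k x \in U) ->
  (0 < i < j)%N -> (j < n)%N ->
  forall x, x \in U -> exterior_projection i j x \in U.
Proof.
move=> UD ij jn x xU; rewrite /exterior_projection.
have [hi hj] : (0 < i < n)%N /\ (0 < j < n)%N by lia.
case: ifP => _; first by rewrite comp_lfunE !UD.
by rewrite scale_lfunE add_lfunE opp_lfunE !comp_lfunE memvZ // memvB // !UD.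
Qed.

Ltac solve_tridiag :=
  first [lia | by apply: tridiag_next; lia | by apply: tridiag_far; lia].

(** D_k moves one index of [u a b] to its neighbour k as long as k is neither equal nor adjacent to
    the other index. Such moves link all non-adjacent pairs; the adjacent ones are then reached by
    [exterior_projection]. *)
Lemma exterior_span_connected (U : {vspace V}) i j :
  (3 < n)%N ->
  (forall k x, (0 < k < n)%N -> x \in U -> D k x \in U) ->
  (0 < i < j)%N -> (j < n)%N -> u i j \in U -> (exterior_span <= U)%VS.
Proof.
move=> n4 UD ij jn uijU.
have left_step a b k : (0 < a < n)%N -> (0 < b < n)%N -> (0 < k < n)%N ->
    T k a = 1 -> T k b = 0 -> u a b \in U -> u k b \in U.
  move=> an bn kn Tka Tkb /(UD k _ kn).
  by rewrite D_u // Tka Tkb scale1r scale0r subr0.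
have right_step a b k : (0 < a < n)%N -> (0 < b < n)%N -> (0 < k < n)%N ->
    T k a = 0 -> T k b = 1 -> u a b \in U -> u a k \in U.
  move=> an bn kn Tka Tkb; rewrite u_anti (u_anti a k) !memvN.
  exact: left_step.
(* The left index goes down to 1, the right one up to n - 1 and back down to any b > 2, and finally
   the left one up again. *)
have u1j : u 1%N j \in U.
  elim: i ij uijU => // -[//|i] IH ij uijU; apply: IH; first lia.
  by apply: (left_step i.+2 j) => //; solve_tridiag.
have u1n : u 1%N n.-1 \in U.
  have [c cE] : exists c, (j + c)%N = n.-1 by exists (n.-1 - j)%N; lia.
  have j2 : (1 < j)%N by lia.
  elim: c j {ij uijU} jn u1j cE j2 => [|c IH] k kn u1k ck k2.
    by rewrite -ck addn0.
  apply: (IH k.+1); try lia; apply: (right_step 1%N k) => //; solve_tridiag.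
have u1 b : (2 < b < n)%N -> u 1%N b \in U.
  move=> bn; have [c cE] : exists c, (b + c)%N = n.-1 by exists (n.-1 - b)%N; lia.
  elim: c b bn cE => [|c IH] b bn cE; first by rewrite -[b]addn0 cE.
  by apply: (right_step 1%N b.+1); [..|apply: IH; lia]; solve_tridiag.
have ufar a b : (0 < a)%N -> (a.+1 < b)%N -> (b < n)%N -> u a b \in U.
  elim: a => // -[_ _ b2 bn|a IH _ ab bn]; first by apply: u1; lia.
  by apply: (left_step a.+1 b); [..|apply: IH; lia]; solve_tridiag.
apply: exterior_span_sub => a b ab bn.
have [far|near] := ltnP a.+1 b; first by apply: ufar; lia.
have {near ab bn} [-> a0 an] : [/\ b = a.+1, (0 < a)%N & (a.+1 < n)%N].
  by split; lia.
have adjacent c d : u c d \in U -> (0 < c < n)%N -> (0 < d < n)%N ->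
    tridiag_minor a a.+1 c d = - (r + r^-1) -> u a a.+1 \in U.
  move=> cdU cn dn cdE; have a01 : (0 < a < a.+1)%N by rewrite a0 /=.
  have := exterior_projection_stable UD a01 an cdU.
  by rewrite exterior_projection_u // cdE rpredZeq oppr_eq0 (negPf rV0).
(* As n >= 4, one of a + 2 and a - 1 is a valid index; the pair (a, a+2), respectively (a-1, a+1),
   is non-adjacent and gives the minor -(r + 1/r). *)
have [a2n|na2] := ltnP a.+2 n.
  apply: (adjacent a a.+2); [by apply: ufar; lia|lia|lia|].
  rewrite /tridiag_minor tridiag_diag // (@tridiag_next _ r a.+1); last lia.
  by rewrite (@tridiag_far _ r a a.+2) ?mul0r ?subr0 ?mulr1 //; lia.
apply: (adjacent a.-1 a.+1); [by apply: ufar; lia|lia|lia|].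
rewrite /tridiag_minor (@tridiag_diag _ r a.+1) // tridiag_next; last lia.
by rewrite mul1r (@tridiag_far _ r a.+1 a.-1) ?mulr0 ?subr0 //; lia.
Qed.

End ExteriorSquareIrreducible.

Lemma tridiagE (F : fieldType) (q : F) i a : (0 < i)%N ->
  tridiag q i a = (a == i.-1)%:R - (q + q^-1) * (a == i)%:R + (a == i.+1)%:R.
Proof.
case: i => // i _; rewrite /tridiag /= eqSS (eq_sym i.+1) (eq_sym i).
have [->|_] := eqVneq a i.+1.
  by rewrite gtn_eqF ?ltn_eqF //= mulr1 addr0 sub0r.
have [->|_] := eqVneq a i; first by rewrite ltn_eqF //= mulr0 subr0 addr0.
by case: eqP => _ /=; rewrite mulr0 subr0 add0r.
Qed.

(** Let C be the antisymmetric matrix with entries [v], extended by zero to the indices 0 and n. The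
    hypothesis says that M = T C T^t vanishes; [quantum_recurrence] removes first the left T, giving
    L = C T^t = 0, and then the right one. *)
Lemma tridiag_minor_eq0 (F : fieldType) (r : F) n (v : LKindex n.-1 -> F) :
  (1 < n)%N -> r != 0 -> r ^+ (2 * n) != 1 ->
  (forall i j, (0 < i < j)%N -> (j < n)%N ->
    \sum_p v p * tridiag_minor r i j (val p).1 (val p).2 = 0) ->
  forall p, v p = 0.
Proof.
move=> n1 r0 rn minor0 p0.
pose C i j := \sum_p v p *
  (((val p).1 == i :> nat)%:R * ((val p).2 == j :> nat)%:R -
   ((val p).2 == i :> nat)%:R * ((val p).1 == j :> nat)%:R).
pose M i j := \sum_p v p * tridiag_minor r i j (val p).1 (val p).2.
have nz (a b : nat) : a != b -> (a == b)%:R = 0 :> F by move/negPf->.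
have C0 i j : (i == 0%N) || (n <= i)%N -> C i j = 0.
  move=> i0; apply: big1 => p _; have [p1 p12 p2] := LKindex_bounds p.
  by rewrite (nz (val p).1 i) ?(nz (val p).2 i); [ring|lia|lia].
have C0' i j : (i == 0%N) || (n <= i)%N -> C j i = 0.
  move=> i0; apply: big1 => p _; have [p1 p12 p2] := LKindex_bounds p.
  by rewrite (nz (val p).1 i) ?(nz (val p).2 i); [ring|lia|lia].
have M0 i j : (0 < i < n)%N -> (0 < j < n)%N -> M i j = 0.
  move=> hi hj; have [ij|ji|->] := ltngtP i j.
  - by apply: minor0; lia.
  - rewrite -[LHS]opprK -[RHS]oppr0 -[in RHS](minor0 j i) /M; [|lia|lia].
    rewrite opprK -sumrN; apply: eq_bigr => p _; rewrite /tridiag_minor; ring.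
  - by apply: big1 => p _; rewrite /tridiag_minor; ring.
pose q := r + r^-1.
pose L i j := C i j.-1 - q * C i j + C i j.+1.
have ML i j : (0 < i)%N -> (0 < j)%N ->
    M i j = L i.-1 j - q * L i j + L i.+1 j.
  move=> i0 j0; rewrite /M /L /C !(mulrDr, mulrN) !mulr_sumr -!(big_split, sumrN) /=.
  apply: eq_bigr => p _; rewrite /tridiag_minor !tridiagE //=.
  rewrite /q; ring.
have L0 i j : (i <= n)%N -> (0 < j < n)%N -> L i j = 0.
  move=> hi hj; apply: (quantum_recurrence (y := fun k => L k j) r0 rn) hi.
  - by rewrite /L !C0 //; ring.
  - by rewrite /L !C0 ?leqnn ?orbT //; ring.
  - move=> k kn; rewrite -ML ?M0 //; lia.
have CE i j : (i <= n)%N -> (j <= n)%N -> C i j = 0.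
  move=> hi; apply: (quantum_recurrence (y := fun k => C i k) r0 rn).
  - by rewrite C0'.
  - by rewrite C0' ?leqnn ?orbT.
  - by move=> k kn; apply: L0.
have [p1 p12 p2] := LKindex_bounds p0.
rewrite -(CE (val p0).1 (val p0).2); [|lia|lia].
rewrite /C (bigD1 p0) //= !eqxx (nz (val p0).2 (val p0).1); last lia.
rewrite mul0r subr0 !mulr1 big1 ?addr0 // => p pp0.
have [p'1 p'12 p'2] := LKindex_bounds p.
have pp : ~~ (((val p).1 == (val p0).1 :> nat) && ((val p).2 == (val p0).2 :> nat)).
  apply: contra pp0 => /andP[/eqP e1 /eqP e2]; apply/eqP/val_inj.
  rewrite [val p]surjective_pairing [val p0]surjective_pairing.
  by congr pair; apply: val_inj.
have -> : ((val p).1 == (val p0).1 :> nat)%:R *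
    ((val p).2 == (val p0).2 :> nat)%:R = 0 :> F.
  by rewrite -natrM mulnb (negPf pp).
(* The second product would need p to be p0 with its entries exchanged, which p.1 < p.2 and p0.1 <
   p0.2 forbid. *)
have [h'|h'] := eqVneq ((val p).2 : nat) (val p0).1.
  rewrite (nz (val p).1 (val p0).2); first ring.
  by rewrite ltn_eqF // (ltn_trans p'12) // h'.
by rewrite mul0r subr0 mulr0.
Qed.

Lemma dim_sum_vlines (F : fieldType) (V : vectType F) (I : finType) (x : I -> V) :
  (forall c : I -> F, \sum_i c i *: x i = 0 -> forall i, c i = 0) ->
  \dim (\sum_i <[x i]>)%VS = #|I|.
Proof.
move=> x_free.
have /directvP -> /= : directv (\sum_i <[x i]>)%VS.
  apply/directv_sum_independent => y yx y0 i _.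
  have [c cE] := fin_all_exists (fun i => vlineP _ _ (yx i isT)).
  rewrite cE (x_free c) ?scale0r // -[RHS]y0.
  by apply: eq_bigr => j _; rewrite cE.
rewrite -sum1_card; apply: eq_bigr => i _; rewrite dim_vline.
(* A zero x_i would give a vanishing combination with coefficients the indicator of i. *)
case: eqP => // xi0; suff /eqP : (i == i)%:R = 0 :> F by rewrite eqxx oner_eq0.
apply: (x_free (fun j => (j == i)%:R)); rewrite (bigD1 i) //= xi0 scaler0 add0r.
by apply: big1 => j /negPf->; rewrite scale0r.
Qed.

Section ExteriorSquareSimple.
Variables (F : fieldType) (r : F) (n : nat) (V : vectType F).
Hypothesis n4 : (3 < n)%N.
Hypothesis r0 : r != 0.
Hypothesis rV0 : r + r^-1 != 0.
Hypothesis rn : r ^+ (2 * n) != 1.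
Local Notation T := (tridiag r).
Variables (D : nat -> 'End(V)) (u : nat -> nat -> V).
Hypothesis u_anti : forall a b, u a b = - u b a.
Hypothesis u_diag : forall a, u a a = 0.
Hypothesis D_u : forall k a b, (0 < k < n)%N -> (0 < a < n)%N -> (0 < b < n)%N ->
  D k (u a b) = T k a *: u k b - T k b *: u k a.
Hypothesis u_neq0 : forall a b, (0 < a < b)%N -> (b < n)%N -> u a b != 0.
Local Notation S := (exterior_span n u).

Lemma exterior_span_simple (U : {vspace V}) : (U <= S)%VS ->
  (forall k x, (0 < k < n)%N -> x \in U -> D k x \in U) -> U = 0%VS \/ U = S.
Proof.
move=> US UD; have [U0|U0] := eqVneq U 0%VS; [by left|right].
apply/eqP; rewrite eqEsubv US /=.
have [/existsP[p upU]|/existsPn upU] :=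
    boolP [exists p : LKindex n.-1, u (val p).1 (val p).2 \in U].
  have [p1 p12 p2] := LKindex_bounds p.
  apply: (exterior_span_connected r0 rV0 u_anti u_diag D_u n4 UD _ p2 upU).
  by rewrite p1.
(* When U contains no u_ij, every projection of the picked vector is a zero multiple of u_ij; by
   [tridiag_minor_eq0] all its coordinates vanish. *)
case/negP: U0; rewrite -vpick0.
have xU := memv_pick U; have [v xE] := exterior_span_coord (subvP US _ xU).
rewrite xE big1 // => p _; rewrite (tridiag_minor_eq0 _ r0 rn) ?scale0r //; first lia.
move=> i j ij jn; have := exterior_projection_stable r0 rV0 UD ij jn xU.
rewrite xE (exterior_projection_sum r0 rV0 u_anti u_diag D_u) // rpredZeq.
case/orP=> [/eqP //|].
have [|q [<- <-] uqU] := @LKindex_exists n.-1 i j ij; first lia.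
by case/negP: (upU q).
Qed.

(** Projecting a vanishing combination to the nonzero [u i j] shows that all its sums of minors
    vanish. *)
Lemma exterior_span_free (v : LKindex n.-1 -> F) :
  \sum_p v p *: u (val p).1 (val p).2 = 0 -> forall p, v p = 0.
Proof.
move=> v0; apply: (tridiag_minor_eq0 _ r0 rn); first lia.
move=> i j ij jn; have /eqP := exterior_projection_sum r0 rV0 u_anti u_diag D_u v ij jn.
rewrite v0 (lfun_linearE (exterior_projection _ _ _ _)).
by rewrite eq_sym scaler_eq0 (negPf (u_neq0 ij jn)) orbF => /eqP.
Qed.

Lemma dim_exterior_span : \dim S = 'C(n.-1, 2).
Proof. by rewrite dim_sum_vlines ?card_LKindex //; apply: exterior_span_free. Qed.

Lemma exterior_span_stable k x : (0 < k < n)%N -> x \in S -> D k x \in S.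
Proof.
move=> kn /exterior_span_coord[v ->]; rewrite lfun_sumE memv_suml // => p _.
have [p1 p12 p2] := LKindex_bounds p; rewrite (lfun_linearE (D k)).
have [h1 h2] : (0 < (val p).1 < n)%N /\ (0 < (val p).2 < n)%N.
  by rewrite p1 p2 (ltn_trans p12 p2) (ltn_trans p1 p12).
by rewrite D_u // memvZ // memvB // memvZ // (exterior_span_u r0 rV0 u_anti u_diag).
Qed.

End ExteriorSquareSimple.

(** * Invariant subspaces and the operators e_i *)

Section InvariantSubspaces.
Variables (F : fieldType) (l r : F) (n : nat).
Hypothesis l0 : l != 0.
Hypothesis r0 : r != 0.
Hypothesis m0 : mparam r != 0.
Local Notation V := (LKspace F n).
Local Notation w := (LKw F n).
Local Notation m := (mparam r).
Local Notation nu := (LKnu l r n).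
Local Notation e := (LKe l r n).
Local Notation invariant := (@LKinvariant F l r n).

Lemma LKw_neq0 s t : (0 < s < t)%N -> (t <= n)%N -> w s t != 0.
Proof.
move=> st tn; have [p [<- <-]] := LKindex_exists st tn.
apply/eqP => /ffunP /(_ p); rewrite !ffunE !eqxx /=; apply/eqP; exact: oner_neq0.
Qed.

Lemma LKe_quadratic i v : e i v = (l / m) *: (nu i (nu i v) + m *: nu i v - v).
Proof.
by rewrite scale_lfunE add_lfunE opp_lfunE add_lfunE comp_lfunE scale_lfunE id_lfunE.
Qed.

Let nuE i := lfun_linearE (nu i).

(** Modulo [w i i.+1], nu_i satisfies the Hecke relation: it acts on w_{s,i}, w_{s,i+1} and on
    w_{i,k}, w_{i+1,k} by Hecke blocks, and by r on disjoint pairs, with r^2 + m r = 1. *)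
Lemma nu_quadratic_w i s t : (0 < i < n)%N ->
  exists c, nu i (nu i (w s t)) + m *: nu i (w s t) - w s t = c *: w i i.+1.
Proof.
move=> hi; have [h|/LKw_out->] := boolP ((0 < s < t)%N && (t <= n)%N); last first.
  by exists 0; rewrite !nuE !scaler0 scale0r !add0r oppr0.
case/andP: h => st tn.
have [sE|si] := eqVneq s i.
  subst s.
  have [tE|ti] := eqVneq t i.+1.
    subst t.
    exists (l^-1 * l^-1 + m * l^-1 - 1).
    by rewrite !(nu_w_simple l r hi, nuE) !scalerA !scalerDl scaleNr scale1r.
  exists (m * r ^+ (t - i - 2)).
  rewrite (@nu_w_left F l r n i t); [|lia|lia].
  rewrite (@nu_w_leftS F l r n i t); [|lia|lia|lia].
  by rewrite subrK addrAC subrr add0r.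
have [sE|si1] := eqVneq s i.+1.
  subst s.
  exists (m * r ^+ (t - i - 2) * l^-1).
  rewrite (@nu_w_leftS F l r n i t); [|lia|lia|lia].
  rewrite !nuE (@nu_w_left F l r n i t); [|lia|lia].
  rewrite (nu_w_simple l r hi) (@nu_w_leftS F l r n i t); [|lia|lia|lia].
  by rewrite subrK addrAC subrr add0r scalerA.
have [tE|ti] := eqVneq t i.
  subst t.
  exists (m / (l * r ^+ (i - s - 1))).
  rewrite (@nu_w_right F l r n i s); [|lia|lia].
  rewrite (@nu_w_rightS F l r n i s); [|lia|lia].
  by rewrite subrK addrAC subrr add0r.
have [tE|ti1] := eqVneq t i.+1.
  subst t.
  exists (m / (l * r ^+ (i - s - 1)) * l^-1).
  rewrite (@nu_w_rightS F l r n i s); [|lia|lia].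
  rewrite !nuE (@nu_w_right F l r n i s); [|lia|lia].
  rewrite (nu_w_simple l r hi) (@nu_w_rightS F l r n i s); [|lia|lia].
  by rewrite subrK addrAC subrr add0r scalerA.
exists 0; rewrite scale0r !(nu_w_disjoint, nuE) // !scalerA.
rewrite -scalerDl -[X in _ - X]scale1r -scalerBl.
suff -> : r * r + m * r - 1 = 0 by rewrite scale0r.
by rewrite /mparam; field.
Qed.

Lemma nu_quadratic i v : (0 < i < n)%N ->
  exists c, nu i (nu i v) + m *: nu i v - v = c *: w i i.+1.
Proof.
move=> hi; have [c cE] := fin_all_exists
  (fun p : LKindex n => nu_quadratic_w (val p).1 (val p).2 hi).
exists (\sum_p v p * c p); rewrite scaler_suml [in LHS](LK_sum_w v) !lfun_sumE.
rewrite scaler_sumr -big_split /= -sumrB; apply: eq_bigr => p _.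
rewrite !nuE [m *: _]scalerA mulrC -scalerA -scalerDr -scalerBr cE scalerA //.
Qed.

(** By the quadratic relation a kernel vector is a multiple of [w i i.+1], an eigenvector for 1/l <>
    0. *)
Lemma LKnu_lker0 i : (0 < i < n)%N -> lker (nu i) == 0%VS.
Proof.
move=> hi; apply/lker0P; suff nu0 x : nu i x = 0 -> x = 0.
  by move=> x y /eqP; rewrite -subr_eq0 -nuE => /eqP /nu0 /eqP;
    rewrite subr_eq0 => /eqP.
move=> nx; have [c] := nu_quadratic x hi; rewrite nx nuE scaler0 !add0r => xE.
move: nx; rewrite -[x]opprK xE !nuE (nu_w_simple l r hi) => /eqP.
rewrite oppr_eq0 scalerA scaler_eq0 mulf_eq0 invr_eq0 (negPf l0) orbF.
case/orP => [/eqP->|]; first by rewrite scale0r oppr0.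
by rewrite (negPf (LKw_neq0 _ _)) //; lia.
Qed.

Lemma LKe_line i v : (0 < i < n)%N -> exists c, e i v = c *: w i i.+1.
Proof.
move=> hi; have [c cE] := nu_quadratic v hi; exists (l / m * c).
by rewrite LKe_quadratic cE scalerA.
Qed.

Lemma LKinvariantP (U : {vspace V}) :
  invariant U <-> forall i x, (0 < i < n)%N -> x \in U -> nu i x \in U.
Proof.
split=> [Uinv i x hi xU|Uinv i hi].
  by apply: (subvP (Uinv i hi)); apply: memv_img.
by apply/subvP => _ /memv_imgP[x xU ->]; apply: Uinv.
Qed.

(** Injectivity and a dimension count give nu_i(U) = U; the equivalence allows membership to be
    traced backwards along the generators. *)
Lemma LKinvariant_nu (U : {vspace V}) i x : invariant U -> (0 < i < n)%N ->
  (nu i x \in U) = (x \in U).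
Proof.
move=> Uinv hi; apply/idP/idP; last by move: i x hi; apply/LKinvariantP.
have UE : (nu i @: U)%VS = U.
  apply/eqP; rewrite eqEdim Uinv //= limg_dim_eq //.
  by rewrite (eqP (LKnu_lker0 hi)) capv0.
by rewrite -{1}UE => /memv_imgP[y yU] /(lker0P (LKnu_lker0 hi)) ->.
Qed.

Lemma LKinvariant_e (U : {vspace V}) i x : invariant U -> (0 < i < n)%N ->
  x \in U -> e i x \in U.
Proof.
move=> /LKinvariantP Uinv hi xU; rewrite LKe_quadratic.
by rewrite memvZ // memvB // memvD ?memvZ // !Uinv.
Qed.

Lemma LKinvariant_full (U : {vspace V}) i : invariant U -> (0 < i < n)%N ->
  w i i.+1 \in U -> U = fullv.
Proof.
move=> Uinv hi wU.
have inU k : (0 < k < n)%N -> forall x, (nu k x \in U) = (x \in U).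
  by move=> hk x; apply: LKinvariant_nu.
(* nu_{j+1} w_{j,j+1} = w_{j,j+2} and nu_j w_{j,j+2} = w_{j+1,j+2}. *)
have step j : (0 < j)%N -> (j.+1 < n)%N -> (w j j.+1 \in U) = (w j.+1 j.+2 \in U).
  move=> j0 jn; rewrite -(inU j.+1) ?nu_w_right; [|lia|lia|lia].
  by rewrite -(inU j) ?nu_w_left //; lia.
have w1 : w 1%N 2%N \in U.
  elim: i hi wU => // -[//|i] IH hi; rewrite -step; [|lia|lia].
  by apply: IH; lia.
have wj j : (0 < j < n)%N -> w j j.+1 \in U.
  by elim: j => // -[//|j] IH hj; rewrite -step; [apply: IH|..]; lia.
have wst c s : (0 < s)%N -> (s.+1 + c <= n)%N -> w s (s.+1 + c) \in U.
  elim: c => [|c IH] s0 sn; first by rewrite addn0 wj //; lia.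
  by rewrite addnS -(@nu_w_right F l r n) ?inU ?IH //; lia.
apply/eqP; rewrite eqEsubv subvf; apply/subvP => x _.
rewrite (LK_sum_w x) memv_suml // => p _; rewrite memvZ //.
case: p => -[a b] /= /andP[a0 ab]; have := ltn_ord b; move=> bn.
by rewrite -(subnKC ab) wst // subnKC.
Qed.

Lemma LKinvariant_sub_ker (U : {vspace V}) : invariant U ->
  (forall i x, (0 < i < n)%N -> x \in U -> e i x = 0) -> (U <= LKker l r n)%VS.
Proof.
move=> Uinv eU; apply/subv_bigcapP => p _; apply/subvP => x xU.
rewrite memv_ker /LKC; case: p => -[a b] /= /andP[a0 ab]; have bn := ltn_ord b.
have : all (fun k => 0 < k < n)%N (index_iota a.+1 b).
  by apply/allP => k; rewrite mem_index_iota; lia.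
have : forall y, y \in U -> e a y = 0.
  by move=> y; apply: eU; lia.
(* Generalised to any operator c that kills U: conjugating it by nu_k preserves this, as U is stable
   under nu_k. *)
elim: (index_iota _ _) (e _) => [|k ks IH] c /= cU; first by move=> _; rewrite cU.
case/andP=> hk hks; apply: IH => // y yU.
by rewrite !comp_lfunE cU ?linear0 ?LKinvariant_nu.
Qed.

Lemma LKker_sub_e i x : (0 < i < n)%N -> x \in LKker l r n -> e i x = 0.
Proof.
move=> hi; have [||p [p1 p2]] := @LKindex_exists n i i.+1; [lia|lia|].
move=> /(subvP (bigcapv_inf p isT (subvv _))).
by rewrite memv_ker /LKC p1 p2 /index_iota subnn => /eqP.
Qed.

Lemma LKinvariant_ker_or_full (U : {vspace V}) : invariant U ->
  (U <= LKker l r n)%VS \/ U = fullv.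
Proof.
move=> Uinv.
have [/existsP [i /andP[i0 /subvPn[x xU]]]|/existsPn eU] :=
    boolP [exists i : 'I_n, (0 < i)%N && ~~ (U <= lker (e i))%VS].
  rewrite memv_ker => ex; right.
  have hi : (0 < i < n)%N by rewrite i0 ltn_ord.
  apply: (LKinvariant_full Uinv hi).
  have := LKinvariant_e Uinv hi xU; have [c cE] := LKe_line x hi.
  by move: ex; rewrite cE scaler_eq0 rpredZeq negb_or => /andP[/negPf->].
left; apply: LKinvariant_sub_ker => // i x /andP[i0 hi] xU.
have := eU (Ordinal hi); rewrite /= i0 /= negbK => /subvP/(_ x xU).
by rewrite memv_ker => /eqP.
Qed.

End InvariantSubspaces.

Lemma dim_LKspace (F : fieldType) n : \dim {:LKspace F n} = 'C(n, 2).
Proof.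
rewrite -card_LKindex -(@dim_sum_vlines F (LKspace F n) _
  (fun p : LKindex n => LKw F n (val p).1 (val p).2)).
  apply/eqP; rewrite eqn_leq [X in _ && X]dimvS ?subvf // andbT dimvS //.
  apply/subvP => x _; rewrite (LK_sum_w x); apply: memv_sumr => p _.
  by rewrite memvZ // memv_line.
move=> c c0 p; suff -> : c p = (\sum_p c p *: LKw F n (val p).1 (val p).2) p.
  by rewrite c0 ffunE.
pose v : LKspace F n := [ffun p => c p].
have -> : c p = v p by rewrite ffunE.
rewrite [in LHS](LK_sum_w v); congr (fun_of_fin _ p).
by apply: eq_bigr => q _; rewrite ffunE.
Qed.

(** * An upper bound for the dimension of K(n) *)

Section KernelDimension.
Variables (F : fieldType) (r : F) (n : nat).
Hypothesis r0 : r != 0.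
Hypothesis m0 : mparam r != 0.
Local Notation l := (- r ^+ 3).
Local Notation V := (LKspace F n).
Local Notation w := (LKw F n).
Local Notation m := (mparam r).
Local Notation nu := (LKnu l r n).
Local Notation e := (LKe l r n).

Let nuE i := lfun_linearE (nu i).

Let l0 : l != 0.
Proof. by rewrite oppr_eq0 expf_neq0. Qed.

(** The diagonal entry is 1 + (1/l - l)/m, which l = -r^3 turns into -(r^2 + r^-2); the entries next
    to it are 1 whatever l is. *)
Lemma LKe_w_simple i j : (0 < i < n)%N -> (0 < j < n)%N ->
  e i (w j j.+1) = tridiag (r ^+ 2) i j *: w i i.+1.
Proof.
move=> hi hj; rewrite LKe_quadratic.
have rm : 1 - r * r != 0.
  apply: contraNneq m0 => /eqP; rewrite subr_eq0 => /eqP r2.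
  by rewrite /mparam subr_eq0 -(inj_eq (mulfI r0)) divff // -r2.
have [jE|[iE|[jE|far]]] : j = i \/ i = j.+1 \/ j = i.+1 \/ (i.+1 < j)%N || (j.+1 < i)%N.
  by lia.
- subst j; rewrite tridiag_diag // !(nu_w_simple l r hi, nuE) !scalerA.
  rewrite -scalerDl -[X in _ - X]scale1r -scalerBl scalerA.
  congr (_ *: _); rewrite /mparam; field.
  by rewrite r0 oppr_eq0 expf_neq0 //= mulNr rm.
- subst i; rewrite tridiag_next ?eqxx //.
  rewrite (@nu_w_right F l r n j.+1 j); [|lia|lia].
  rewrite (@nu_w_rightS F l r n j.+1 j); [|lia|lia].
  rewrite subrK addrAC subrr add0r scalerA subSnn subnn expr0.
  congr (_ *: _); rewrite /mparam; field.
  by rewrite r0 oppr_eq0 expf_neq0 //= mulNr rm.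
- subst j; rewrite tridiag_next ?eqxx ?orbT //.
  rewrite (@nu_w_leftS F l r n i i.+2); [|lia|lia|lia].
  rewrite !nuE (@nu_w_left F l r n i i.+2); [|lia|lia].
  rewrite (nu_w_simple l r hi) (@nu_w_leftS F l r n i i.+2); [|lia|lia|lia].
  rewrite subrK addrAC subrr add0r !scalerA.
  rewrite (_ : (i.+2 - i - 2 = 0)%N) ?expr0; last lia.
  congr (_ *: _); rewrite /mparam; field.
  by rewrite r0 oppr_eq0 expf_neq0 //= mulNr rm.
rewrite tridiag_far // scale0r !(nu_w_disjoint, nuE) //; try lia.
rewrite !scalerA -scalerDl -[X in _ - X]scale1r -scalerBl.
suff -> : r * r + m * r - 1 = 0 by rewrite scale0r scaler0.
by rewrite /mparam; field.
Qed.

(** Only w_{1,2}, ..., w_{q-1,q} and e_1, ..., e_{q-1} enter, so that a leading block can be used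
    when the full matrix is singular: q is n in general and n - 1 when r^(2n) = -1. *)
Lemma LKsimple_free q (c : 'I_q.-1 -> F) : (q <= n)%N ->
  (r ^+ 2) ^+ (2 * q) != 1 ->
  (forall i, (0 < i < q)%N -> e i (\sum_j c j *: w j.+1 j.+2) = 0) ->
  forall j, c j = 0.
Proof.
move=> qn rq ec0.
(* The coefficients shifted by one and padded with zeros at 0 and q, as [quantum_recurrence]
   requires. *)
pose y k := \sum_j c j * (j.+1 == k)%:R.
have yc (j : 'I_q.-1) : y j.+1 = c j.
  rewrite /y (bigD1 j) //= eqxx mulr1 big1 ?addr0 // => k kj.
  by move: kj; rewrite -(inj_eq val_inj) eqSS => /negPf /= ->; rewrite mulr0.
move=> j; rewrite -yc.
apply: (quantum_recurrence (n := q) (q := r ^+ 2)); rewrite ?expf_neq0 //.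
- by apply: big1 => k _; rewrite mulr0.
- apply: big1 => k _; rewrite (_ : (_ == _) = false) ?mulr0 //.
  by apply/negP => /eqP; have := ltn_ord k; lia.
- move=> i hi; have := ec0 i hi; rewrite lfun_sumE.
  rewrite (eq_bigr (fun j => (c j * tridiag (r ^+ 2) i j.+1) *: w i i.+1)).
    rewrite -scaler_suml => /eqP; rewrite scaler_eq0.
    rewrite (negPf (LKw_neq0 _ _ _)) ?orbF; [|lia|lia].
    move=> /eqP <-; rewrite /y !mulr_sumr -sumrN -!big_split /=.
    by apply: eq_bigr => k _; rewrite tridiagE; [ring|lia].
  move=> k _; rewrite (lfun_linearE (e i)) LKe_w_simple ?scalerA //; first lia.
  by have := ltn_ord k; lia.
by have := ltn_ord j; lia.
Qed.

(** All e_i kill K, so by [LKsimple_free] K meets the span of the first q - 1 vectors w_{j,j+1}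
    trivially. *)
Lemma dim_LKker_le q : (q <= n)%N -> (r ^+ 2) ^+ (2 * q) != 1 ->
  (\dim (LKker l r n) + q.-1 <= 'C(n, 2))%N.
Proof.
move=> qn rq.
pose W : {vspace V} := (\sum_(j < q.-1) <[w j.+1 j.+2]>)%VS.
have dW : \dim W = q.-1.
  rewrite dim_sum_vlines ?card_ord // => c c0; apply: (LKsimple_free qn rq) => i _.
  by rewrite c0 (lfun_linearE (e i)).
have KW : (LKker l r n :&: W)%VS = 0%VS.
  apply/eqP; rewrite -subv0; apply/subvP => x; rewrite memv_cap => /andP[xK xW].
  case/memv_sumP: xW => y yw xE.
  have [c cE] := fin_all_exists (fun j => vlineP _ _ (yw j isT)).
  have xc : x = \sum_j c j *: w j.+1 j.+2 by rewrite xE; apply: eq_bigr => j _.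
  rewrite xc big1 ?mem0v // => j _; rewrite (LKsimple_free qn rq) ?scale0r //.
  by move=> i hi; rewrite -xc; apply: (LKker_sub_e l0 r0 m0 _ xK); lia.
have := dimvS (subvf (LKker l r n + W)%VS).
by rewrite dimv_disjoint_sum // dW dim_LKspace.
Qed.

End KernelDimension.

(** * The common eigenvector when r^(2n) = -1 *)

Lemma sum_pred_diff (Z : zmodType) (phi : nat -> Z) a b N : (a < b <= N)%N ->
  \sum_(s < N | (a < s < b)%N) (phi s - phi s.-1) = phi b.-1 - phi a.
Proof.
case/andP=> ab bN; case: b ab bN => // b ab bN.
transitivity (\sum_(a.+1 <= s < b.+1) (phi s - phi s.-1)).
  rewrite big_geq_mkord (big_ord_widen_cond _ (fun s => a < s)%N
    (fun s => phi s - phi s.-1) bN).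
  by apply: eq_bigl => s.
by rewrite big_add1 /= telescope_sumr.
Qed.

Section Eigenvector.
Variables (F : fieldType) (r : F) (n : nat).
Hypothesis r0 : r != 0.
Hypothesis rn : r ^+ (2 * n) = -1.
Local Notation l := (- r ^+ 3).
Local Notation V := (LKspace F n).
Local Notation w := (LKw F n).
Local Notation m := (mparam r).
Local Notation nu := (LKnu l r n).

(** Summing over all s and t is harmless, since [w s t] is 0 outside the range, and lets rows and
    columns be split off freely. *)
Definition LKeigenvector : V :=
  \sum_(s < n.+1) \sum_(t < n.+1) r ^+ (s + t) *: w s t.

Lemma LKeigenvectorE (p : LKindex n) :
  LKeigenvector p = r ^+ ((val p).1 + (val p).2).
Proof.
rewrite sum_ffunE (bigD1 (val p).1) //= sum_ffunE (bigD1 (val p).2) //=.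
rewrite !ffunE !eqxx [_ *: _]mulr1 big1 ?addr0 => [|t tp].
  rewrite big1 ?addr0 // => s sp; rewrite sum_ffunE big1 // => t _.
  have /negPf ps : ((val p).1 : nat) != s by rewrite (inj_eq val_inj) eq_sym.
  by rewrite !ffunE ps scaler0.
have /negPf pt : ((val p).2 : nat) != t by rewrite (inj_eq val_inj) eq_sym.
by rewrite !ffunE pt andbF scaler0.
Qed.

(** The contribution of the pair (s, t) to nu_i x - r x, for x the eigenvector. *)
Let f i s t : V := r ^+ (s + t) *: (nu i (w s t) - r *: w s t).

Let f0 i s t : ~~ ((0 < s < t)%N && (t <= n)%N) -> f i s t = 0.
Proof. by move=> st; rewrite /f LKw_out // linear0 scaler0 subrr scaler0. Qed.

Let f_disjoint i s t : s != i -> s != i.+1 -> t != i -> t != i.+1 -> f i s t = 0.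
Proof. by move=> *; rewrite /f nu_w_disjoint // subrr scaler0. Qed.

Let f_right i s : (i < n)%N -> (0 < s < i)%N ->
  f i s i + f i s i.+1 = (r ^+ (2 * s) - r ^+ (2 * s.-1)) *: w i i.+1.
Proof.
move=> ni /andP[s0 si]; rewrite /f nu_w_right // nu_w_rightS ?s0 //.
have [c ->] : exists c, i = (s + c.+1)%N by exists (i - s.+1)%N; lia.
case: s s0 {si} => // s _ /=.
rewrite (_ : (s.+1 + c.+1 - s.+1 - 1 = c)%N); last lia.
rewrite (_ : (2 * s.+1 = s + s + 2)%N); last lia.
rewrite (_ : (2 * s = s + s)%N); last lia.
rewrite (_ : (s.+1 + (s.+1 + c.+1).+1 = s + s + c + 4)%N); last lia.
rewrite (_ : (s.+1 + (s.+1 + c.+1) = s + s + c + 3)%N); last lia.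
rewrite !exprD.
move: (w _ _) (w _ _) (w _ _) => x y z.
apply/ffunP => p; rewrite !ffunE /GRing.scale /= /mparam.
by field; rewrite r0 expf_neq0 // oppr_eq0 expf_neq0.
Qed.

Let f_left i t : (0 < i)%N -> (i.+1 < t <= n)%N ->
  f i i t + f i i.+1 t = (r ^+ (2 * t.-1) - r ^+ (2 * t)) *: w i i.+1.
Proof.
move=> i0 /andP[it tn]; rewrite /f nu_w_left // nu_w_leftS //.
have [c tE] : exists c, t = (i + c.+2)%N by exists (t - i.+2)%N; lia.
rewrite tE (_ : (i + c.+2 - i - 2 = c)%N); last lia.
rewrite (_ : (2 * (i + c.+2).-1 = i + i + c + c + 2)%N); last lia.
rewrite (_ : (2 * (i + c.+2) = i + i + c + c + 4)%N); last lia.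
rewrite (_ : (i.+1 + (i + c.+2) = i + i + c + 3)%N); last lia.
rewrite (_ : (i + (i + c.+2) = i + i + c + 2)%N); last lia.
rewrite !exprD.
move: (w _ _) (w _ _) (w _ _) => x y z.
apply/ffunP => p; rewrite !ffunE /GRing.scale /= /mparam.
by field.
Qed.

Let f_middle i : (0 < i < n)%N ->
  f i i i.+1 = - (r ^+ (2 * i.-1) + r ^+ (2 * i.+1)) *: w i i.+1.
Proof.
move=> hi; rewrite /f nu_w_simple // -scalerBl scalerA; congr (_ *: _).
case: i hi => // i _ /=.
rewrite (_ : (i.+1 + i.+2 = 2 * i + 3)%N); last lia.
rewrite (_ : (2 * i.+2 = 2 * i + 4)%N); last lia.
by rewrite !exprD; field; rewrite oppr_eq0 expf_neq0.
Qed.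

(** Pairs that miss i and i+1 contribute 0. The others combine into multiples of w_{i,i+1} with
    telescoping coefficients, whose ends cancel against [f_middle] up to -1 - r^(2n) = 0. *)
Lemma nu_LKeigenvector i : (0 < i < n)%N ->
  nu i LKeigenvector = r *: LKeigenvector.
Proof.
move=> hi; apply/eqP; rewrite -subr_eq0; apply/eqP.
have -> : nu i LKeigenvector - r *: LKeigenvector =
    \sum_(s < n.+1) \sum_(t < n.+1) f i s t.
  rewrite lfun_sumE scaler_sumr -sumrB; apply: eq_bigr => s _.
  rewrite lfun_sumE scaler_sumr -sumrB; apply: eq_bigr => t _.
  by rewrite (lfun_linearE (nu i)) scalerA mulrC -scalerA -scalerBr.
have [i1 i2] : (i < n.+1)%N /\ (i.+1 < n.+1)%N by lia.
pose a := Ordinal i1; pose b := Ordinal i2.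
have ba : b != a by rewrite -(inj_eq val_inj) /=; lia.
have neq_ord (c d : 'I_n.+1) : c != d -> (c : nat) != d by rewrite (inj_eq val_inj).
(* Rows i and i+1 are added column by column, for [f_middle] and [f_left]; in each other row only
   columns i and i+1 survive, for [f_right]. *)
rewrite (bigD1 a) //= [X in _ + X](bigD1 b) //= addrA -big_split /=.
rewrite [X in _ + X](eq_bigr (fun s : 'I_n.+1 => (if (0 < s < i)%N then
   r ^+ (2 * s) - r ^+ (2 * s.-1) else 0) *: w i i.+1)); last first.
  move=> s /andP[/neq_ord sa /neq_ord sb].
  rewrite (bigD1 a) //= (bigD1 b) //= big1 ?addr0; last first.
    by move=> t /andP[/neq_ord ta /neq_ord tb]; apply: f_disjoint.
  case: ifP => hs; first by rewrite f_right //; lia.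
  move: sa sb => /= sa sb.
  by rewrite !f0 ?addr0 ?scale0r //; lia.
rewrite (bigD1 b) //= f_middle // (@f0 i i.+1 i.+1) ?addr0; last lia.
rewrite (eq_bigr (fun t : 'I_n.+1 => (if (i.+1 < t < n.+1)%N then
   r ^+ (2 * t.-1) - r ^+ (2 * t) else 0) *: w i i.+1)); last first.
  move=> t /neq_ord tb; have := ltn_ord t; move: tb => /= tb tn.
  case: ifP => ht; first by rewrite f_left //; lia.
  by rewrite !f0 ?addr0 ?scale0r //; lia.
rewrite -!scaler_suml -!scalerDl -!big_mkcondr /=.
have -> : \sum_(t < n.+1 | (t != b) && (i.+1 < t < n.+1)%N)
    (r ^+ (2 * t.-1) - r ^+ (2 * t)) = r ^+ (2 * i.+1) - r ^+ (2 * n).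
  have hin : (i.+1 < n.+1 <= n.+1)%N by lia.
  rewrite -[RHS]opprB; have /= <- := sum_pred_diff (fun t => r ^+ (2 * t)) hin.
  rewrite -sumrN; apply: eq_big => [t|t _]; last by rewrite opprB.
  by rewrite -(inj_eq val_inj) /=; lia.
have -> : \sum_(s < n.+1 | (s != a) && (s != b) && (0 < s < i)%N)
    (r ^+ (2 * s) - r ^+ (2 * s.-1)) = r ^+ (2 * i.-1) - r ^+ (2 * 0).
  have hi0 : (0 < i <= n.+1)%N by lia.
  have /= <- := sum_pred_diff (fun t => r ^+ (2 * t)) hi0.
  by apply: eq_bigl => s; rewrite -!(inj_eq val_inj) /=; lia.
rewrite rn muln0 expr0 (_ : _ + _ = 0) ?scale0r //; ring.
Qed.

End Eigenvector.

(** * Semisimplicity of the Hecke algebra *)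

Section Conjugation.
Variables (F : fieldType) (H B : algType F) (u v : B).
Hypotheses (uv : u * v = 1) (vu : v * u = 1).
Variable phi : {lrmorphism H -> B}.

(** The two identities are arguments so that the morphism structures can be attached to the map. *)
Definition lr_conj of u * v = 1 & v * u = 1 := fun h : H => u * phi h * v.
Local Notation conj := (lr_conj uv vu).

Fact lr_conj_linear : linear conj.
Proof.
move=> a x y; rewrite /lr_conj linearP mulrDr mulrDl.
by rewrite -scalerAr -scalerAl.
Qed.

Fact lr_conj_monoid_morphism : monoid_morphism conj.
Proof.
split; rewrite /lr_conj; first by rewrite rmorph1 mulr1.
by move=> x y; rewrite rmorphM !mulrA -(mulrA _ v u) vu mulr1.
Qed.

HB.instance Definition _ := GRing.isLinear.Build F H B *:%R conj lr_conj_linear.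
HB.instance Definition _ :=
  GRing.isMonoidMorphism.Build H B conj lr_conj_monoid_morphism.
End Conjugation.

(** Conjugation by the unit 1 + N turns phi into a morphism with the same values on the generators;
    the uniqueness in the universal property identifies the two. *)
Lemma hecke_commute (F : fieldType) (r : F) n (H : algType F) (g : nat -> H)
    (B : algType F) (phi : {lrmorphism H -> B}) (N : B) :
  is_hecke_algebra r n g -> N * N = 0 ->
  (forall i, (0 < i < n)%N -> N * phi (g i) = phi (g i) * N) ->
  forall h, N * phi h = phi h * N.
Proof.
case=> -[g2 gbraid gfar] univ NN Ng h.
have uv : (1 + N) * (1 - N) = 1.
  by rewrite mulrDl mul1r mulrBr mulr1 NN subr0 subrK.
have vu : (1 - N) * (1 + N) = 1.
  by rewrite mulrBl mul1r mulrDr mulr1 NN addr0 addrK.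
have [|f [_ f_uniq]] := univ B (phi \o g).
  split=> [i hi|i i0 hi|i j i0 ij jn] /=.
  - by rewrite -rmorphXn -linearZZ -rmorphD g2 ?rmorph1.
  - by rewrite -!rmorphM gbraid.
  - by rewrite -!rmorphM gfar.
have phiE := f_uniq phi (fun _ _ => erefl).
have conjE : lr_conj phi uv vu =1 f.
  apply: f_uniq => i hi; rewrite /= /lr_conj mulrDl mul1r Ng //.
  by rewrite -[X in X + _]mulr1 -mulrDr -mulrA uv mulr1.
have : (1 + N) * phi h * (1 - N) = phi h.
  exact: etrans (conjE h) (esym (phiE h)).
move=> /(congr1 ( *%R^~ (1 + N))); rewrite -mulrA vu mulr1 mulrDl mulrDr mul1r mulr1.
by move/addrI.
Qed.

Lemma row_right_inverse (F : fieldType) k (f : 'rV[F]_k) : f != 0 ->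
  exists c : 'cV_k, f *m c = 1%:M.
Proof.
case/rV0Pn => j fj; exists ((f 0 j)^-1 *: delta_mx j 0).
rewrite -scalemxAr -colE; apply/matrixP => a b; rewrite !ord1 !mxE mulVf //.
Qed.

Lemma col_left_inverse (F : fieldType) k (e : 'cV[F]_k) : e != 0 ->
  exists d : 'rV_k, d *m e = 1%:M.
Proof.
move=> e0; have [|c cE] := @row_right_inverse F k e^T.
  by rewrite -(inj_eq trmx_inj) trmxK trmx0.
by exists c^T; rewrite -[e]trmxK -trmx_mul cE trmx1.
Qed.

(* Complete reducibility of H splits off the submodule on which H acts through the
   character g_i |-> r, giving z with g_i z = r z which fixes e0. *)
Lemma hecke_semisimple_split (F : fieldType) (r : F) n (H : algType F)
    (g : nat -> H) k (G : nat -> 'M[F]_k.+1) (e0 : 'cV_k.+1) (f : 'rV_k.+1) :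
  is_hecke_algebra r n g -> semisimple_ring H -> hecke_relations r n G ->
  e0 != 0 -> f != 0 -> f *m e0 = 0 ->
  (forall i, (0 < i < n)%N -> G i *m e0 = r *: e0) ->
  (forall i, (0 < i < n)%N -> f *m G i = r *: f) ->
  exists v : 'cV_k.+1, f *m v = 1%:M /\
    forall i, (0 < i < n)%N -> G i *m v = r *: v.
Proof.
move=> Hg Hss GH e0_neq0 f_neq0 fe0 Ge0 fG.
have [phi [phig _]] := Hg.2 _ _ GH.
have [c fc] := row_right_inverse f_neq0.
have [d de] := col_left_inverse e0_neq0.
(* The matrix e0 f has square 0 because f e0 = 0, and commutes with each G_i because both products
   are r e0 f. *)
have phiN h : (e0 *m f) *m phi h = phi h *m (e0 *m f).
  apply: (hecke_commute Hg) => [|i hi].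
    by rewrite -mulmxE mulmxA -(mulmxA e0) fe0 mulmx0 mul0mx.
  by rewrite phig // -!mulmxE -mulmxA fG // mulmxA Ge0 // -scalemxAl -scalemxAr.
(* The left ideal is the annihilator of e0, and z is the component of 1 in its complement J; (g_i -
   r) z lies in both, hence is 0. *)
have [|J [[J0 JD JM] IJ Jfull]] := Hss (fun h => phi h *m e0 = 0).
  split=> [|x y xe ye|a x xe]; first by rewrite rmorph0 mul0mx.
    by rewrite rmorphD mulmxDl xe ye addr0.
  by rewrite rmorphM -mulmxE -mulmxA xe mulmx0.
have [y [z [ye Jz yz]]] := Jfull 1.
have ze : phi z *m e0 = e0.
  have := congr1 (fun h => phi h *m e0) yz.
  by rewrite rmorphD rmorph1 mulmxDl ye add0r mul1mx.
have phiB p q : phi (p - q) = phi p - phi q by exact: raddfB.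
have phiZ p : phi (r *: p) = r *: phi p by exact: linearZZ.
have phiM p q : phi (p * q) = phi p *m phi q by exact: rmorphM.
have gz i : (0 < i < n)%N -> g i * z = r *: z.
  move=> hi; apply/eqP; rewrite -subr_eq0; apply/eqP; apply: IJ.
    rewrite phiB phiZ phiM mulmxBl -mulmxA ze phig // Ge0 //.
    by rewrite -scalemxAl ze subrr.
  by rewrite -[r *: z]mulr_algl -mulrBl; apply: JM.
have fz : f *m phi z = f.
  rewrite -[LHS]mul1mx -de -mulmxA [e0 *m _]mulmxA phiN mulmxA.
  by rewrite -(mulmxA d) (mulmxA _ e0) ze mulmxA de mul1mx.
exists (phi z *m c); split; first by rewrite mulmxA fz.
move=> i hi; by rewrite -phig // mulmxA -phiM gz // phiZ scalemxAl.
Qed.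

(** For g = r + A, (g - r)(g + 1/r) = A (A + r + 1/r) = 0. *)
Lemma hecke_quadratic (F : fieldType) (r : F) (B : algType F) (A : B) :
  r != 0 -> A * A = - (r + r^-1) *: A ->
  (r%:A + A) ^+ 2 + mparam r *: (r%:A + A) = 1.
Proof.
move=> r0 AA; rewrite expr2 mulrDl !mulrDr AA !mulr_algl mulr_algr.
rewrite scalerDr !scalerA.
transitivity ((r * r + mparam r * r) *: 1 +
    (r + r + - (r + r^-1) + mparam r) *: A :> B).
  move: (mparam r) => m.
  by rewrite !scalerDl !addrA [LHS](ACl (1*5*2*3*4*6)).
have -> : r + r + - (r + r^-1) + mparam r = 0 by rewrite /mparam; ring.
have -> : r * r + mparam r * r = 1 by rewrite /mparam; field.
by rewrite scale0r addr0 scale1r.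
Qed.

(** Under these Temperley-Lieb relations the expansion of the left side is symmetric in A and C. *)
Lemma hecke_braid (F : fieldType) (r : F) (B : algType F) (A C : B) :
  r != 0 -> A * A = - (r + r^-1) *: A -> C * C = - (r + r^-1) *: C ->
  A * C * A = A -> C * A * C = C ->
  (r%:A + A) * (r%:A + C) * (r%:A + A) = (r%:A + C) * (r%:A + A) * (r%:A + C).
Proof.
move=> r0 AA CC ACA CAC.
have side (X Y : B) : X * X = - (r + r^-1) *: X -> X * Y * X = X ->
    (r%:A + X) * (r%:A + Y) * (r%:A + X) =
    (r * r * r)%:A + (r * r) *: (X + Y) + r *: (X * Y + Y * X).
  move=> XX XYX.
  have -> : (r%:A + X) * (r%:A + Y) = (r * r)%:A + r *: X + r *: Y + X * Y.
    rewrite mulrDl !mulrDr !mulr_algl mulr_algr scalerA !addrA.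
    by rewrite [LHS](ACl (1*3*2*4)).
  rewrite mulrDr mulr_algr !mulrDl mulr_algl -!scalerAl XX XYX !scalerDr !scalerA.
  transitivity ((r * (r * r))%:A + (r * r + r * r + r * - (r + r^-1) + 1) *: X
      + (r * r) *: Y + r *: (X * Y) + r *: (Y * X)).
    by rewrite !scalerDl scale1r !addrA [LHS](ACl (1*2*5*6*8*3*4*7)).
  have -> : r * r + r * r + r * - (r + r^-1) + 1 = r * r by field.
  by rewrite mulrA !addrA.
by rewrite (side A C) // (side C A) // (addrC A) (addrC (A * C)).
Qed.

Lemma tridiag_sym (F : fieldType) (q : F) i j : tridiag q i j = tridiag q j i.
Proof. by rewrite /tridiag eq_sym orbC. Qed.

(** * The Burau representation and the consequences of semisimplicity *)

Section Burau.
Variables (F : fieldType) (r : F) (k : nat).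
Hypothesis r0 : r != 0.

(** Coordinates start at 0 but generators at 1: coordinate 0 supplies the vector on which every
    generator acts by r. *)
Definition burau_col i : 'cV[F]_k.+1 := \col_a tridiag r a i.
Definition burau_row i : 'rV[F]_k.+1 := \row_b (b == i :> nat)%:R.
Definition burau_part i : 'M[F]_k.+1 := burau_col i *m burau_row i.

Lemma burau_rowE i (x : 'cV[F]_k.+1) (ik : (i < k.+1)%N) :
  burau_row i *m x = (x (Ordinal ik) 0)%:M.
Proof.
apply/matrixP => a b; rewrite !ord1 !mxE (bigD1 (Ordinal ik)) //= !mxE eqxx mul1r.
rewrite big1 ?addr0 ?mulr1n // => c ci; rewrite !mxE.
by move: ci; rewrite -(inj_eq val_inj) => /negPf /= ->; rewrite mul0r.
Qed.

Lemma burau_part_mul i j : (i < k.+1)%N ->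
  burau_part i * burau_part j = tridiag r i j *: (burau_col i *m burau_row j).
Proof.
move=> ik; rewrite /burau_part -mulmxE mulmxA -(mulmxA (burau_col i)).
by rewrite burau_rowE mxE /= mul_mx_scalar -scalemxAl.
Qed.

Lemma burau_relations : hecke_relations r k.+1 (fun i => r%:A + burau_part i).
Proof.
have AA i : (i < k.+1)%N -> burau_part i * burau_part i = - (r + r^-1) *: burau_part i.
  by move=> ik; rewrite burau_part_mul // tridiag_diag.
have AAA i j : (i < k.+1)%N -> (j < k.+1)%N -> (i == j.+1) || (j == i.+1) ->
    burau_part i * burau_part j * burau_part i = burau_part i.
  move=> ik jk ij; rewrite burau_part_mul // tridiag_next // scale1r.
  rewrite /burau_part -mulmxE mulmxA -(mulmxA (burau_col i)) burau_rowE mxE /=.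
  by rewrite tridiag_next ?mulmx1 // orbC.
split=> [i /andP[_ hi]|i _ hi|i j _ ij jn].
- by apply: hecke_quadratic => //; apply: AA.
- by apply: hecke_braid; rewrite ?AA ?AAA ?eqxx ?orbT //; lia.
rewrite !mulrDl !mulrDr !mulr_algl !mulr_algr !burau_part_mul //; try lia.
by rewrite !tridiag_far ?scale0r ?addr0; [rewrite addrAC|lia..].
Qed.

Lemma burau_mul_col i (x : 'cV[F]_k.+1) (ik : (i < k.+1)%N) :
  (r%:A + burau_part i) *m x = r *: x + x (Ordinal ik) 0 *: burau_col i.
Proof.
rewrite mulmxDl -scalemxAl mul1mx -mulmxA burau_rowE.
by rewrite mul_mx_scalar.
Qed.

Lemma burau_mul_row i (f : 'rV[F]_k.+1) : f *m burau_col i = 0 ->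
  f *m (r%:A + burau_part i) = r *: f.
Proof.
by move=> ft; rewrite mulmxDr -scalemxAr mulmx1 mulmxA ft mul0mx addr0.
Qed.

End Burau.

(** If r^(2n) = 1, the row f of unnormalised quantum integers kills all the [burau_col], so the
    character r is also a quotient. A splitting vector v would be supported on coordinate 0, where f
    vanishes, against f v = 1. *)
Lemma semisimple_quantum (F : fieldType) (r : F) n (H : algType F) (g : nat -> H) :
  (1 < n)%N -> r != 0 -> r - r^-1 != 0 -> is_hecke_algebra r n g ->
  semisimple_ring H -> r ^+ (2 * n) != 1.
Proof.
case: n => // k k0 r0 r2 Hg Hss; apply/eqP => rn.
pose phi a : F := r ^+ a - r ^- a.
have phin : phi k.+1 = 0.
  apply/eqP; rewrite subr_eq0 -(inj_eq (mulfI (expf_neq0 k.+1 r0))).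
  by rewrite divff ?expf_neq0 // -exprD addnn -mul2n rn.
pose f : 'rV[F]_k.+1 := \row_a phi a.
have ft i : (0 < i < k.+1)%N -> f *m burau_col r k i = 0.
  move=> hi; apply/matrixP => a b; rewrite !mxE.
  (* The case j = k + 1 lies outside the row and holds because [phi] vanishes there. *)
  have sum_delta j : (j <= k.+1)%N ->
      \sum_(c < k.+1) phi c * (c == j :> nat)%:R = phi j.
    rewrite leq_eqVlt => /orP[/eqP->|jk].
      rewrite phin big1 // => c _; rewrite ltn_eqF ?mulr0 //; exact: ltn_ord.
    rewrite (bigD1 (Ordinal jk)) //= eqxx mulr1 big1 ?addr0 // => c.
    by rewrite -(inj_eq val_inj) /= => /negPf->; rewrite mulr0.
  rewrite (eq_bigr (fun c : 'I_k.+1 => phi c * (c == i.-1 :> nat)%:R -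
      (r + r^-1) * (phi c * (c == i :> nat)%:R) +
      phi c * (c == i.+1 :> nat)%:R)); last first.
    move=> c _; rewrite !mxE tridiag_sym tridiagE; [ring|lia].
  rewrite big_split sumrB /= -mulr_sumr !sum_delta; [|lia..].
  case: i hi => // i _ /=; rewrite /phi !exprS; field.
  by rewrite r0 expf_neq0.
have f_neq0 : f != 0.
  apply/eqP => /matrixP /(_ 0 (Ordinal k0)); rewrite !mxE /phi /= !expr1 => /eqP.
  by rewrite (negPf r2).
have [||||v [fv Gv]] := hecke_semisimple_split (e0 := delta_mx 0 0) Hg Hss
    (burau_relations k r0) _ f_neq0.
- apply/eqP => /matrixP /(_ 0 0); rewrite !mxE !eqxx => /eqP; by rewrite oner_eq0.
- by rewrite -colE; apply/matrixP => a b; rewrite !mxE /phi expr0 invr1 subrr.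
- move=> i /andP[i0 ik]; rewrite (burau_mul_col r _ ik) mxE -(inj_eq val_inj) /=.
  by rewrite gtn_eqF // scale0r addr0.
- by move=> i hi; apply: burau_mul_row; apply: ft.
(* G_i v = r v says that v_i times [burau_col] i is 0, and this column has the entry 1 in row i -
   1. *)
have v0 i (ik : (i < k.+1)%N) : (0 < i)%N -> v (Ordinal ik) 0 = 0.
  move=> i0; have i1k : (i.-1 < k.+1)%N by lia.
  have := Gv i; rewrite i0 ik => /(_ isT).
  rewrite (burau_mul_col r _ ik) -[RHS]addr0 => /addrI.
  move/matrixP/(_ (Ordinal i1k) 0); rewrite !mxE /= tridiag_next ?mulr1 //; lia.
have := congr1 (fun M : 'M_1 => M 0 0) fv; rewrite !mxE /= big1 => [/eqP|a _].
  by rewrite eq_sym oner_eq0.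
case: a => -[|a] ak; first by rewrite !mxE /phi /= expr0 invr1 subrr mul0r.
by rewrite v0 ?mulr0.
Qed.

(** If r + 1/r = 0, letting every generator act by the Jordan block r + N satisfies the relations,
    and this block does not split. *)
Lemma semisimple_sqr_neqN1 (F : fieldType) (r : F) n (H : algType F) (g : nat -> H) :
  (1 < n)%N -> r != 0 -> is_hecke_algebra r n g -> semisimple_ring H -> r + r^-1 != 0.
Proof.
move=> n1 r0 Hg Hss; apply/eqP => rV.
pose N : 'M[F]_2 := delta_mx 0 1.
have NN : N * N = - (r + r^-1) *: N.
  by rewrite rV oppr0 scale0r -mulmxE mul_delta_mx_0.
have GH : hecke_relations r n (fun=> r%:A + N).
  by split=> // i _; apply: hecke_quadratic.
have [|||||v [fv Gv]] := hecke_semisimple_split (e0 := delta_mx 0 0)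
    (f := delta_mx 0 1) Hg Hss GH.
- by apply/eqP => /matrixP /(_ 0 0); rewrite !mxE !eqxx => /eqP; rewrite oner_eq0.
- by apply/eqP => /matrixP /(_ 0 1); rewrite !mxE !eqxx => /eqP; rewrite oner_eq0.
- by rewrite mul_delta_mx_0.
- by move=> i _; rewrite mulmxDl -scalemxAl mul1mx mul_delta_mx_0 // addr0.
- by move=> i _; rewrite mulmxDr -scalemxAr mulmx1 mul_delta_mx_0 // addr0.
have := Gv 1%N n1; rewrite mulmxDl -scalemxAl mul1mx -[RHS]addr0 => /addrI.
move=> /(congr1 (mulmx (delta_mx 0 0 : 'rV_2))).
rewrite mulmxA mul_delta_mx fv mulmx0 => /matrixP /(_ 0 0).
by rewrite !mxE => /eqP; rewrite oner_eq0.
Qed.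

Lemma subr_add_cancel (Z : zmodType) (x a b : Z) : x + a - b - x = a - b.
Proof. by rewrite -2!addrA addrC -!addrA addNr addr0. Qed.

(** * The kernel K(n) *)

Section Classification.
Variables (F : fieldType) (r : F) (n : nat).
Hypothesis n5 : (5 <= n)%N.
Hypothesis r0 : r != 0.
Hypothesis m0 : mparam r != 0.
Hypothesis rV0 : r + r^-1 != 0.
Hypothesis rn : r ^+ (2 * n) != 1.
Local Notation l := (- r ^+ 3).
Local Notation V := (LKspace F n).
Local Notation nu := (LKnu l r n).
Local Notation K := (LKker l r n).
Local Notation invariant := (@LKinvariant F l r n).
Local Notation irreducible := (@LKirreducible F l r n).
Local Notation d := 'C(n.-1, 2).

Definition LKsquare : {vspace V} := exterior_span n (LKu r n).
Local Notation S := LKsquare.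

Let l0 : l != 0. Proof. by rewrite oppr_eq0 expf_neq0. Qed.
Let D k : 'End(V) := nu k - r *: \1%VF.

Let D_u k a b : (0 < k < n)%N -> (0 < a < n)%N -> (0 < b < n)%N ->
  D k (LKu r n a b) =
    tridiag r k a *: LKu r n k b - tridiag r k b *: LKu r n k a.
Proof.
move=> kn an bn; rewrite /D lfun_shiftE (nu_LKu r0 kn an bn).
exact: subr_add_cancel.
Qed.

Let D_stable (U : {vspace V}) :
  invariant U <-> forall k x, (0 < k < n)%N -> x \in U -> D k x \in U.
Proof.
split=> [/LKinvariantP Uinv k x kn xU|UD].
  by rewrite /D lfun_shiftE memvB ?memvZ // Uinv.
apply/LKinvariantP => k x kn xU; have := UD k x kn xU.
by rewrite /D lfun_shiftE => /memvD /(_ (memvZ r xU)); rewrite subrK.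
Qed.

Lemma LKu_neq0 a b : (0 < a < b)%N -> (b < n)%N -> LKu r n a b != 0.
Proof.
move=> ab bn; have [|p [p1 p2]] := @LKindex_exists n a b ab; first exact: ltnW.
(* The coordinate of the vector at (a, b) is 1. *)
apply/eqP => /ffunP /(_ p); rewrite !ffunE p1 p2 !eqxx /=.
have -> : (a == b) = false by lia.
have -> : (a == a.+1) = false by lia.
have -> : (b == b.+1) = false by lia.
rewrite /= (_ : (a == b.+1) = false) /=; last lia.
rewrite !subr0 !addr0 !scaler0 subr0 addr0 => /eqP.
by rewrite oner_eq0.
Qed.

Let n4 : (3 < n)%N. Proof. exact: leq_trans n5. Qed.

Lemma LKsquare_irreducible : irreducible S.
Proof.
split; first apply/D_stable.
- exact: (exterior_span_stable r0 rV0 (LKu_anti r n) (LKu_diag r n) D_u).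
- have h12 : (0 < 1 < n)%N /\ (0 < 2 < n)%N by lia.
  move=> S0; have := exterior_span_u r0 rV0 (LKu_anti r n) (LKu_diag r n) h12.1 h12.2.
  by rewrite -/S S0 memv0; apply/negP/LKu_neq0 => //; lia.
- move=> W WS /D_stable WD.
  exact: (exterior_span_simple n4 r0 rV0 rn (LKu_anti r n) (LKu_diag r n) D_u WS WD).
Qed.

Lemma dim_LKsquare : \dim S = d.
Proof.
exact: (dim_exterior_span n4 r0 rV0 rn (LKu_anti r n) (LKu_diag r n) D_u LKu_neq0).
Qed.

Let binn : ('C(n, 2) = d + n.-1)%N.
Proof. by case: (n) n5 => // k _; rewrite binS bin1 addnC. Qed.

Lemma LKsquare_sub_ker : (S <= K)%VS.
Proof.
have [Sinv _ _] := LKsquare_irreducible.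
case: (LKinvariant_ker_or_full l0 r0 m0 Sinv) => // Sfull.
have := dim_LKsquare; rewrite Sfull dim_LKspace binn; lia.
Qed.

Lemma LKinvariant_line x c : (forall i, (0 < i < n)%N -> nu i x = c *: x) ->
  invariant <[x]>%VS.
Proof.
move=> xc; apply/LKinvariantP => i y hi /vlineP[a ->].
by rewrite (lfun_linearE (nu i)) xc // !memvZ // memv_line.
Qed.

Let d_gt1 : (1 < d)%N.
Proof.
by case: (n) n5 => [|[|[|[|[|k]]]]] // _; rewrite /= !binS !bin1 !bin0; lia.
Qed.

(** The bound with q = n is C(n, 2) - (n - 1), the dimension of S; (r^2)^(2n) <> 1 because r^(2n) is
    neither 1 nor -1. *)
Lemma LKker_generic : r ^+ (2 * n) != -1 -> K = S.
Proof.
move=> rnN; apply/eqP; rewrite eq_sym eqEdim LKsquare_sub_ker dim_LKsquare /=.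
have := dim_LKker_le r0 m0 (leqnn n); rewrite exprAC sqrf_eq1 negb_or rn rnN.
by move=> /(_ isT); rewrite binn leq_add2r.
Qed.

Section Exceptional.
Hypothesis rnN : r ^+ (2 * n) = -1.
Local Notation x := (LKeigenvector r n).

Lemma LKeigenvector_neq0 : x != 0.
Proof.
have [||p _] := @LKindex_exists n 1 2; [by []|lia|].
apply/eqP => /ffunP /(_ p) /eqP.
by rewrite LKeigenvectorE ffunE expf_eq0 (negPf r0) andbF.
Qed.

Let x_inv : invariant <[x]>%VS.
Proof. by apply: (@LKinvariant_line _ r) => i hi; apply: nu_LKeigenvector. Qed.

Lemma LKeigenvector_notin_square : x \notin S.
Proof.
have [_ _ Smin] := LKsquare_irreducible.
apply/negP => xS; have := dim_LKsquare.
have [|x0|<-] := Smin <[x]>%VS xS; first exact: x_inv.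
  by have := LKeigenvector_neq0; rewrite -memv0 -x0 memv_line.
by rewrite dim_vline LKeigenvector_neq0; have := d_gt1; lia.
Qed.

Lemma LKeigenvector_cap_square : (<[x]> :&: S)%VS = 0%VS.
Proof.
apply/eqP; rewrite -subv0; apply/subvP => y; rewrite memv_cap => /andP[/vlineP[c ->]].
rewrite rpredZeq (negPf LKeigenvector_notin_square) orbF => /eqP->.
by rewrite scale0r mem0v.
Qed.

(** Both summands are invariant and not full, hence inside K, and the bound with q = n - 1 is d +
    1. *)
Lemma LKker_exceptional : (<[x]> + S)%VS = K.
Proof.
apply/eqP; rewrite eqEdim subv_add LKsquare_sub_ker andbT; apply/andP; split.
  case: (LKinvariant_ker_or_full l0 r0 m0 x_inv) => // xfull.
  have := dim_LKspace F n; rewrite -xfull dim_vline binn; have := d_gt1; lia.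
rewrite dimv_disjoint_sum ?LKeigenvector_cap_square // dim_LKsquare.
rewrite dim_vline LKeigenvector_neq0.
(* As r^(4n) = 1, this power is r^-4, and r^4 <> 1 because r^2 is neither 1 nor -1. *)
suff r4n : (r ^+ 2) ^+ (2 * n.-1) != 1.
  by have := dim_LKker_le r0 m0 (leq_pred n) r4n; rewrite binn; lia.
have r2 : r ^+ 2 != 1.
  apply: contraNneq m0 => rr; rewrite /mparam subr_eq0 -(inj_eq (mulfI r0)).
  by rewrite divff // -expr2 rr.
have r2N : r ^+ 2 != -1.
  apply: contraNneq rV0 => rr; rewrite -(inj_eq (mulfI r0)) mulr0 mulrDr divff //.
  by rewrite -expr2 rr addNr.
have : (r ^+ 2) ^+ (2 * n.-1) * (r ^+ 2) ^+ 2 = 1.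
  rewrite -exprD (_ : (2 * n.-1 + 2 = 2 * n)%N); last lia.
  by rewrite exprAC rnN sqrrN expr1n.
move=> r4; apply: contra_neq r2 => rn1; move: r4; rewrite rn1 mul1r => /eqP.
by rewrite sqrf_eq1 (negPf r2N) orbF => /eqP.
Qed.

Lemma LKeigenvector_unique (W : {vspace V}) :
  invariant W -> \dim W = 1%N -> W = <[x]>%VS.
Proof.
move=> Winv W1; have [Sinv _ Smin] := LKsquare_irreducible.
have WK : (W <= K)%VS.
  case: (LKinvariant_ker_or_full l0 r0 m0 Winv) => // Wfull.
  move: W1; rewrite Wfull dim_LKspace binn; have := d_gt1; lia.
have W0 : W != 0%VS by apply/eqP => W0; rewrite W0 dimv0 in W1.
pose y := vpick W; have y0 : y != 0 by rewrite vpick0.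
have Wy : W = <[y]>%VS.
  apply/esym/eqP; rewrite eqEdim -memvE memv_pick W1 dim_vline y0 //.
have := subvP WK _ (memv_pick W); rewrite -LKker_exceptional.
case/memv_addP => _ /vlineP[c ->] [s sS yE].
have eig i : (0 < i < n)%N -> exists a, nu i y = a *: y.
  move=> hi; move/LKinvariantP: Winv => /(_ i y hi (memv_pick W)).
  by rewrite Wy => /vlineP.
have SinvP := (LKinvariantP _ _ S).1 Sinv.
(* If c = 0 the line W lies in the irreducible S, of dimension d > 1. Otherwise the x-component
   forces eigenvalue r, so s spans an invariant subspace of S and must be 0. *)
have [c0|c0] := eqVneq c 0.
  have [|WE|WS] := Smin W _ Winv; last by move: W1; rewrite WS dim_LKsquare; lia.
    by rewrite Wy -memvE /y yE c0 scale0r add0r.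
  by rewrite WE eqxx in W0.
have s_eig i : (0 < i < n)%N -> nu i s = r *: s.
  move=> hi; have [a aE] := eig i hi.
  have : (c * (r - a)) *: x = a *: s - nu i s.
    have := aE; rewrite /y yE !(lfun_linearE (nu i)).
    rewrite (nu_LKeigenvector r0 rnN hi) scalerDr => E.
    apply/eqP; rewrite eq_sym subr_eq mulrBr scalerBl addrAC -scalerA E.
    by rewrite scalerA [a * c]mulrC addrAC subrr add0r.
  have : a *: s - nu i s \in S by rewrite memvB ?memvZ // SinvP.
  move=> /[swap] xE; rewrite -xE rpredZeq (negPf LKeigenvector_notin_square) orbF.
  move=> ca; move: xE; rewrite (eqP ca) scale0r => /esym/eqP.
  move: ca; rewrite mulf_eq0 (negPf c0) /= subr_eq0 => /eqP <-.
  by rewrite subr_eq0 => /eqP.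
have s0 : s = 0.
  have [|sE|sE] := Smin <[s]>%VS sS; first exact: LKinvariant_line s_eig.
    by apply/eqP; rewrite -memv0 -sE memv_line.
  by have := dim_LKsquare; rewrite -sE dim_vline; case: eqP => //= _; lia.
apply/eqP; rewrite eqEdim W1 dim_vline LKeigenvector_neq0 andbT.
by rewrite Wy -memvE /y yE s0 addr0 memvZ // memv_line.
Qed.

Lemma LKsquare_unique (W : {vspace V}) : irreducible W -> \dim W = d -> W = S.
Proof.
case=> Winv W0 Wmin Wd; have [Sinv _ Smin] := LKsquare_irreducible.
have WK : (W <= K)%VS.
  case: (LKinvariant_ker_or_full l0 r0 m0 Winv) => // Wfull.
  by move: Wd; rewrite Wfull dim_LKspace binn; lia.
have capinv : invariant (W :&: S)%VS.
  apply/LKinvariantP => i y hi; rewrite !memv_cap => /andP[yW yS].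
  by rewrite ((LKinvariantP _ _ W).1 Winv) // ((LKinvariantP _ _ S).1 Sinv).
(* A trivial intersection would give 2d <= d + 1, against d > 1. *)
have [cap0|capW] := Wmin _ (capvSl W S) capinv.
  have : (W + S <= <[x]> + S)%VS.
    by rewrite LKker_exceptional subv_add WK LKsquare_sub_ker.
  move/dimvS; rewrite !dimv_disjoint_sum ?LKeigenvector_cap_square //.
  by rewrite Wd dim_LKsquare dim_vline LKeigenvector_neq0; have := d_gt1; lia.
by apply/eqP; rewrite eqEdim -capW capvSr capW Wd dim_LKsquare leqnn.
Qed.

End Exceptional.

End Classification.

(** * The two cases over an arbitrary field, and the transfer to Q(l, r) *)

Lemma LK_classification_generic (F : fieldType) (r : F) n :
  (5 <= n)%N -> r != 0 -> mparam r != 0 -> r + r^-1 != 0 ->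
  r ^+ (2 * n) != 1 -> r ^+ (2 * n) != -1 ->
  let K := LKker (- r ^+ 3) r n in
  [/\ LKirreducible (- r ^+ 3) r K, \dim K = 'C(n.-1, 2) &
    forall U : {vspace LKspace F n},
      (LKinvariant (- r ^+ 3) r U /\ LKproper U) <-> U = K].
Proof.
move=> n5 r0 m0 rV0 rn rnN K; rewrite /K (LKker_generic n5 r0 m0 rV0 rn rnN).
have Sirr := LKsquare_irreducible n5 r0 m0 rV0 rn.
have Sdim := dim_LKsquare n5 r0 m0 rV0 rn.
have [Sinv S0 Smin] := Sirr.
have l0 : - r ^+ 3 != 0 by rewrite oppr_eq0 expf_neq0.
split=> // U; split=> [[Uinv [U0 Ufull]]|->].
  case: (LKinvariant_ker_or_full l0 r0 m0 Uinv) => //.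
  by rewrite (LKker_generic n5 r0 m0 rV0 rn rnN) => US; case: (Smin U US Uinv).
split=> //; split=> // Sfull; have := Sdim; rewrite Sfull dim_LKspace.
case: n n5 {K Sirr Sdim Sinv S0 Smin Sfull rn rnN U} => // k k5.
by rewrite binS bin1 /=; lia.
Qed.

Lemma LK_classification_exceptional (F : fieldType) (r : F) n :
  (5 <= n)%N -> r != 0 -> mparam r != 0 -> r + r^-1 != 0 ->
  r ^+ (2 * n) != 1 -> r ^+ (2 * n) = -1 ->
  let l := - r ^+ 3 in let K := LKker l r n in let d := 'C(n.-1, 2) in
  [/\ LKreducible l r K, \dim K = (1 + d)%N &
    exists U1 U2 : {vspace LKspace F n},
      [/\ LKinvariant l r U1 /\ \dim U1 = 1%N,
          forall W, LKinvariant l r W -> \dim W = 1%N -> W = U1,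
          LKirreducible l r U2 /\ \dim U2 = d,
          forall W, LKirreducible l r W -> \dim W = d -> W = U2
        & (U1 + U2)%VS = K /\ (U1 :&: U2)%VS = 0%VS]].
Proof.
move=> n5 r0 m0 rV0 rn rnN l K d.
have Sirr := LKsquare_irreducible n5 r0 m0 rV0 rn.
have Sdim := dim_LKsquare n5 r0 m0 rV0 rn.
have [Sinv S0 Smin] := Sirr.
have KE := LKker_exceptional n5 r0 m0 rV0 rn rnN.
have cap0 := LKeigenvector_cap_square n5 r0 m0 rV0 rn rnN.
have x_inv := LKinvariant_line (fun i hi => nu_LKeigenvector r0 rnN hi).
have xdim : \dim <[LKeigenvector r n]> = 1%N.
  by rewrite dim_vline (LKeigenvector_neq0 n5 r0 m0 rV0 rn).
have Kdim : \dim K = (1 + d)%N by rewrite /K -KE dimv_disjoint_sum // xdim Sdim.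
have Kinv : LKinvariant l r K.
  rewrite /K -KE; apply/LKinvariantP => i y hi /memv_addP[a ax [b bS ->]].
  rewrite linearD memv_add //.
    by move/LKinvariantP: x_inv; apply.
  by move/LKinvariantP: Sinv; apply.
split=> //.
  split=> //; exists (LKsquare r n); split=> //.
    exact: LKsquare_sub_ker n5 r0 m0 rV0 rn.
  by move=> SK; have := Kdim; rewrite -SK Sdim -/d; lia.
exists <[LKeigenvector r n]>%VS, (LKsquare r n); split=> //.
- by move=> W; apply: LKeigenvector_unique.
- by move=> W; apply: LKsquare_unique.
Qed.

Theorem theorem7 (R : realType) (l r : R[i]) (n : nat)
    (l_neq0 : l != 0) (r_neq0 : r != 0) (r2_neq1 : r ^+ 2 != 1)
    (n_ge5 : (5 <= n)%N)
    (H : algType (Qlr l r)) (g : nat -> H)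
    (H_hecke : is_hecke_algebra (Qlr_r l r) n g)
    (H_semisimple : semisimple_ring H) :
  let inv := @LKinvariant (Qlr l r) (Qlr_l l r) (Qlr_r l r) n in
  let irred := @LKirreducible (Qlr l r) (Qlr_l l r) (Qlr_r l r) n in
  let reducible := @LKreducible (Qlr l r) (Qlr_l l r) (Qlr_r l r) n in
  let K := LKker (Qlr_l l r) (Qlr_r l r) n in
  let d := ((n - 1) * (n - 2) %/ 2)%N in
  (l = - r ^+ 3 -> r ^+ (2 * n) <> -1 ->
    [/\ irred K,
        \dim K = d
      & forall U : {vspace LKspace (Qlr l r) n},
          (inv U /\ LKproper U) <-> U = K]) /\
  (l = - r ^+ 3 -> r ^+ (2 * n) = -1 ->
    [/\ reducible K,
        \dim K = (1 + d)%N
      & exists U1 U2 : {vspace LKspace (Qlr l r) n},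
          [/\ inv U1 /\ \dim U1 = 1%N,
              forall W, inv W -> \dim W = 1%N -> W = U1,
              irred U2 /\ \dim U2 = d,
              forall W, irred W -> \dim W = d -> W = U2
            & (U1 + U2)%VS = K /\ (U1 :&: U2)%VS = 0%VS]]).
Proof.
move=> inv irred reducible K d.
pose r' := Qlr_r l r.
have r'0 : r' != 0 by apply: contraNneq r_neq0 => /(congr1 val) /= ->.
have r'2 : r' ^+ 2 != 1.
  by apply: contraNneq r2_neq1 => /(congr1 val); rewrite rmorphXn rmorph1 /= => ->.
have m0 : mparam r' != 0.
  apply: contraNneq r'2; rewrite /mparam => /eqP; rewrite subr_eq0 => /eqP rV.
  by rewrite expr2 -{1}rV mulVf.
have n1 : (1 < n)%N by apply: leq_trans n_ge5.
have rV0 : r' + r'^-1 != 0 := semisimple_sqr_neqN1 n1 r'0 H_hecke H_semisimple.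
have rn : r' ^+ (2 * n) != 1.
  by apply: (semisimple_quantum n1 r'0 _ H_hecke H_semisimple); rewrite -oppr_eq0 opprB.
have dE : d = 'C(n.-1, 2) by rewrite /d bin2 divn2 subn1 subn2.
(* Relations between l and r in the complex numbers hold in Q(l, r) since the inclusion is an
   injective morphism. *)
have lE : l = - r ^+ 3 -> Qlr_l l r = - r' ^+ 3.
  by move=> lr; apply: val_inj; rewrite rmorphN rmorphXn.
rewrite /inv /irred /reducible /K dE; split=> /lE -> rN.
  apply: LK_classification_generic => //; apply/eqP => /(congr1 val).
  by rewrite rmorphXn rmorphN rmorph1.
apply: LK_classification_exceptional => //.
by apply: val_inj; rewrite rmorphXn rmorphN rmorph1.
Qed.
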